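(* The decision problem \textsc{Min-Max-Dec} (given an instance $(N,P,T,(\mathbf{D}_i)_{i\in N})$ and a set of constraints $\mathbf{A}$, decide whether there is an outcome $\mathbf{o}$ with $\max_{i\in N} d_i(\mathbf{o}^{(t)})\le\lambda$ for every $(t,\lambda)\in\mathbf{A}$) is fixed-parameter tractable with respect to the parameter $n+\tau$.
   Context: An instance is a tuple $(N,P,T,(\mathbf{D}_i)_{i\in N})$ with agents $N=[n]$, projects $P=\{p_1,\dots,p_m\}$, timesteps $T=[\ell]$, and for each agent $i$ and timestep $k$ a disapproval set $D_{ik}\subseteq P$. An outcome is $\mathbf{o}=(o_1,\dots,o_\ell)$ with $o_k\in P$; $\mathbf{o}^{(k)}=(o_1,\dots,o_k)$, and $d_i(\mathbf{o}^{(k)})=|\{t\in[k]: o_t\in D_{it}\}|$. A set of constraints is $\mathbf{A}=\{(t_1,\lambda_1),\dots,(t_\tau,\lambda_\tau)\}$ with $t_j\in T$, $\lambda_j\in\{0,\dots,\ell\}$, $t_1\le\dots\le t_\tau$, $\lambda_1\le\dots\le\lambda_\tau$, and $\tau=|\mathbf{A}|$. *)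

(* Defs.v *)
From mathcomp Require Import all_boot all_order.
Set Implicit Arguments. Unset Strict Implicit. Unset Printing Implicit Defensive.

(* Agents N = 'I_n, projects P = 'I_m, timesteps T = [l] represented by *)
(* 'I_l (ordinal k stands for timestep k+1).                            *)
(* D i k = disapproval set of agent i at timestep k+1.                  *)

Definition disapp (n m l : nat) (D : 'I_n -> 'I_l -> {set 'I_m})
  (o : 'I_l -> 'I_m) (i : 'I_n) (t : nat) : nat :=
  #|[set k : 'I_l | (k < t) && (o k \in D i k)]|.

Definition valid_constraints (l : nat) (A : seq (nat * nat)) : bool :=
  [&& uniq A,
      all (fun c => (0 < c.1 <= l) && (c.2 <= l)) A,
      sorted leq (map fst A) & sorted leq (map snd A)].

Definition min_max_dec (n m l : nat) (D : 'I_n -> 'I_l -> {set 'I_m})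
  (A : seq (nat * nat)) : Prop :=
  exists o : 'I_l -> 'I_m,
    forall c, c \in A -> \max_(i < n) disapp D o i c.1 <= c.2.

Definition encode (n m l : nat) (D : 'I_n -> 'I_l -> {set 'I_m})
  (A : seq (nat * nat)) : seq nat :=
  [:: n; m; l] ++
  flatten [seq flatten [seq [seq nat_of_bool (p \in D i k) | p <- enum 'I_m]
                        | k <- enum 'I_l] | i <- enum 'I_n] ++
  (size A :: flatten [seq [:: c.1; c.2] | c <- A]).

(* Machine model: unit-cost RAM with addition and truncated            *)
(* subtraction (no multiplication), indirect addressing, and a          *)
(* read-only input tape.  This model is polynomially equivalent to      *)
(* Turing machines.                                                     *)
Inductive instr : Type :=
| ILoad  of nat & nat
| IAdd   of nat & nat & nat
| ISub   of nat & nat & nat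
| IRead  of nat & nat
| IWrite of nat & nat
| IIn    of nat & nat
| IJz    of nat & nat
| IJmp   of nat
| IHalt.

Record rstate := RSt { pc : nat; regs : nat -> nat }.

Definition upd (f : nat -> nat) (a v : nat) : nat -> nat :=
  fun x => if x == a then v else f x.

Definition step (p : seq instr) (inp : seq nat) (s : rstate) : rstate :=
  let R := regs s in
  match nth IHalt p (pc s) with
  | ILoad r c => RSt (pc s).+1 (upd R r c)
  | IAdd r a b => RSt (pc s).+1 (upd R r (R a + R b))
  | ISub r a b => RSt (pc s).+1 (upd R r (R a - R b))
  | IRead r a => RSt (pc s).+1 (upd R r (R (R a)))
  | IWrite a b => RSt (pc s).+1 (upd R (R a) (R b))
  | IIn r a => RSt (pc s).+1 (upd R r (nth 0 inp (R a)))
  | IJz a t => RSt (if R a == 0 then t else (pc s).+1) R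
  | IJmp t => RSt t R
  | IHalt => s
  end.

Definition halted (p : seq instr) (s : rstate) : bool :=
  if nth IHalt p (pc s) is IHalt then true else false.

Definition init_state (inp : seq nat) : rstate :=
  RSt 0 (fun r => if r == 0 then size inp else 0).

Definition run (p : seq instr) (inp : seq nat) (k : nat) : rstate :=
  iter k (step p inp) (init_state inp).

Definition halts_within (p : seq instr) (inp : seq nat) (k out : nat) : Prop :=
  exists j, j <= k /\ halted p (run p inp j) /\ regs (run p inp j) 0 = out.

Definition computable (f : nat -> nat) : Prop :=
  exists p : seq instr, forall x, exists j,
    halted p (run p [:: x] j) /\ regs (run p [:: x] j) 0 = f x.

(* Main.v *)
Require Import Defs.
From mathcomp Require Import all_boot all_order all_algebra zify.
Set Implicit Arguments. Unset Strict Implicit. Unset Printing Implicit Defensive.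

(* The algorithm is a local search on the total violation, the sum over       *)
(* constraints (t, lambda) and agents i of the positive part of               *)
(* d_i(o^(t)) - lambda.  If o violates something and o* is feasible, the      *)
(* timesteps where they differ can be split into groups of size bounded in    *)
(* d = n tau such that, in each of the d coordinates (constraint, agent), the *)
(* effects of switching a group from o to o* all have the same sign.  A group *)
(* that helps a violated coordinate moves every coordinate towards its value  *)
(* at o*, so switching it lowers the violation while changing boundedly many  *)
(* timesteps.  Such an improvement is found by dynamic programming over the   *)
(* timesteps: the table holds one outcome for each profile of differences     *)
(* from the current outcome inside a box of radius depending on d only.  The  *)
(* initial violation is at most n tau l, so polynomially many rounds suffice. *)

(** * A structured language compiled to the RAM *)

(** Put d = n tau and call a pair (constraint, agent) a coordinate. An outcome is feasible exactly
    when its total violation, a natural number at most n tau l, vanishes. Two facts suffice: in a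
    solvable instance every infeasible outcome is improved by changing boundedly many timesteps, the
    bound depending on d only; and such a change is found in fixed-parameter time.

    The first fact is [improvement]. Switching one timestep from the current outcome to a feasible
    one moves each coordinate by -1, 0 or 1. For a single coordinate, [same_sign_groups] uses a
    Steinitz-type argument: integers bounded by B can be ordered with prefix sums in [-B, B] until
    the remaining ones have one sign, and pigeonhole on prefix sums cuts out short pieces of sum
    zero. Iterating over the coordinates, [sign_coherent_groups] yields groups of size at most
    [group_bound d], no two of which pull a coordinate in opposite directions. A group that helps a
    violated coordinate therefore pushes no coordinate beyond its value at the feasible outcome, and
    no positive part grows.

    The second fact is [round_correct]. Outcomes at Hamming distance below g have profiles strictly
    inside a box of (2g+1)^d cells. The violation depends on the profile alone, so one stored
    outcome per cell is enough; [key_inj] and [fill_step_covers] carry this dynamic program.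

    An explicit machine with a computable time bound is obtained by writing the algorithm in a loop
    language. [compile_correct] transfers its meaning to the RAM and bounds the time by loop
    lengths. All loop lengths are at most [growth d] times the input length and the nesting depth is
    a constant, so [time_bound_poly] and [time_bound_fpt] give 2^2^(x^2 + K) times a polynomial,
    where x = n + tau and 2 d <= x^2. *)

Inductive expr : Type :=
| Const of nat
| Var of nat
| Plus of expr & expr
| Minus of expr & expr
| Input of expr
| Arr of nat & expr.

Inductive cmd : Type :=
| Skip
| Assign of nat & expr
| Store of nat & expr & expr
| Seq of cmd & cmd
| If of expr & cmd & cmd
| For of nat & expr & cmd.

Record store := Sto { vars : nat -> nat; arrs : nat -> nat -> nat }.

Definition set_var s x v := Sto (upd (vars s) x v) (arrs s).
Definition set_arr s a i v :=
  Sto (vars s) (fun b => if b == a then upd (arrs s a) i v else arrs s b).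

(** * Semantics of the loop language and its loop lengths *)

Section Semantics.
Variable inp : seq nat.

Fixpoint eval (e : expr) (s : store) : nat :=
  match e with
  | Const c => c
  | Var x => vars s x
  | Plus a b => eval a s + eval b s
  | Minus a b => eval a s - eval b s
  | Input a => nth 0 inp (eval a s)
  | Arr a b => arrs s a (eval b s)
  end.

(** A loop fixes its number of rounds on entry, so every command terminates and the semantics is a
    total function. *)
Fixpoint exec (c : cmd) (s : store) : store :=
  match c with
  | Skip => s
  | Assign x e => set_var s x (eval e s)
  | Store a e1 e2 => set_arr s a (eval e1 s) (eval e2 s)
  | Seq c1 c2 => exec c2 (exec c1 s)
  | If e c1 c2 => if eval e s == 0 then exec c2 s else exec c1 s
  | For x e c => foldl (fun s k => exec c (set_var s x k)) s (iota 0 (eval e s))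
  end.

(* All loops entered from [s] make at most [W] rounds; [time_bound] below     *)
(* turns this into a bound on the running time.                               *)
Fixpoint loops_le (W : nat) (c : cmd) (s : store) : Prop :=
  match c with
  | Seq c1 c2 => loops_le W c1 s /\ loops_le W c2 (exec c1 s)
  | If e c1 c2 => if eval e s == 0 then loops_le W c2 s else loops_le W c1 s
  | For x e c => eval e s <= W /\ forall k, k < eval e s ->
      loops_le W c (set_var
        (foldl (fun s k => exec c (set_var s x k)) s (iota 0 k)) x k)
  | _ => True
  end.

End Semantics.

(* Memory layout: variables in [0, 32), loop counters in [32, 48), a register *)
(* that stays zero at 48, expression temporaries in [49, 64), and entry [i]   *)
(* of array [a < 8] at 64 + 8 i + a.                                          *)
Definition represents (s : store) (mem : nat -> nat) :=
  [/\ forall x, x < 32 -> mem x = vars s x,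
      forall a i, a < 8 -> mem (64 + 8 * i + a) = arrs s a i
    & mem 48 = 0].

(* Turns an index in register [r] into the address of that entry of array [a]. *)
Definition address_code (r a : nat) : seq instr :=
  [:: IAdd r r r; IAdd r r r; IAdd r r r; ILoad r.+1 (64 + a); IAdd r r r.+1].
Arguments address_code : simpl never.

Lemma size_address_code r a : size (address_code r a) = 5. Proof. by []. Qed.

(** Stack discipline: the value lands in [r] and the second operand is computed one register higher.
    Adding register 48, which stays zero, serves as a copy instruction. *)
Fixpoint compile_expr (e : expr) (r : nat) : seq instr :=
  match e with
  | Const c => [:: ILoad r c]
  | Var x => [:: IAdd r x 48]
  | Plus a b => compile_expr a r ++ compile_expr b r.+1 ++ [:: IAdd r r r.+1]
  | Minus a b => compile_expr a r ++ compile_expr b r.+1 ++ [:: ISub r r r.+1]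
  | Input a => compile_expr a r ++ [:: IIn r r]
  | Arr a e => compile_expr e r ++ address_code r a ++ [:: IRead r r]
  end.

(** The bound is 63 and not 64 because an array access also uses [r.+1], which must stay below the
    array area. *)
Fixpoint wf_expr (e : expr) (r : nat) : bool :=
  (49 <= r) && (r < 63) &&
  match e with
  | Const c => true
  | Var x => x < 32
  | Plus a b | Minus a b => wf_expr a r && wf_expr b r.+1
  | Input a => wf_expr a r
  | Arr a e => (a < 8) && wf_expr e r
  end.

Fixpoint cmd_size (c : cmd) : nat :=
  match c with
  | Skip => 0
  | Assign x e => size (compile_expr e 49) + 1
  | Store a e1 e2 => size (compile_expr e1 49) + 5 + size (compile_expr e2 50) + 1
  | Seq c1 c2 => cmd_size c1 + cmd_size c2
  | If e c1 c2 => size (compile_expr e 49) + 1 + cmd_size c1 + 1 + cmd_size c2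
  | For x e c => size (compile_expr e 49) + 2 + 4 + cmd_size c + 3
  end.

(* [d] is the loop nesting depth, [off] the address of the first instruction. *)
Fixpoint compile (d off : nat) (c : cmd) : seq instr :=
  match c with
  | Skip => [::]
  | Assign x e => compile_expr e 49 ++ [:: IAdd x 49 48]
  | Store a e1 e2 => compile_expr e1 49 ++ address_code 49 a ++
      compile_expr e2 50 ++ [:: IWrite 49 50]
  | Seq c1 c2 => compile d off c1 ++ compile d (off + cmd_size c1) c2
  | If e c1 c2 =>
      let o1 := off + size (compile_expr e 49) + 1 in
      let o2 := o1 + cmd_size c1 + 1 in
      compile_expr e 49 ++ [:: IJz 49 o2] ++ compile d o1 c1 ++
      [:: IJmp (o2 + cmd_size c2)] ++ compile d o2 c2
  | For x e c =>
      let bound := 32 + 2 * d in let counter := 33 + 2 * d in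
      let top := off + size (compile_expr e 49) + 2 in
      compile_expr e 49 ++ [:: IAdd bound 49 48; ILoad counter 0] ++
      [:: IJz bound (top + 4 + cmd_size c + 3); ILoad 49 1;
          ISub bound bound 49; IAdd x counter 48] ++
      compile d.+1 (top + 4) c ++
      [:: ILoad 49 1; IAdd counter counter 49; IJmp top]
  end.

Fixpoint wf_cmd (d : nat) (c : cmd) : bool :=
  match c with
  | Skip => true
  | Assign x e => (x < 32) && wf_expr e 49
  | Store a e1 e2 => [&& a < 8, wf_expr e1 49 & wf_expr e2 50]
  | Seq c1 c2 => wf_cmd d c1 && wf_cmd d c2
  | If e c1 c2 => [&& wf_expr e 49, wf_cmd d c1 & wf_cmd d c2]
  | For x e c => [&& x < 32, d < 8, wf_expr e 49 & wf_cmd d.+1 c]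
  end.

(** Each round of a loop costs 4 instructions before and 3 after the body; the 3 outside are the two
    initialisations and the final exit jump. *)
Fixpoint time_bound (W : nat) (c : cmd) : nat :=
  match c with
  | Seq c1 c2 => time_bound W c1 + time_bound W c2
  | If e c1 c2 =>
      size (compile_expr e 49) + 2 + time_bound W c1 + time_bound W c2
  | For x e c => size (compile_expr e 49) + 3 + W * (time_bound W c + 7)
  | _ => cmd_size c
  end.

Fixpoint depth (c : cmd) : nat :=
  match c with
  | Seq c1 c2 | If _ c1 c2 => maxn (depth c1) (depth c2)
  | For _ _ c => (depth c).+1
  | _ => 0
  end.

(** Only nesting multiplies costs. The base [W.+1] is positive, so powers for shallower subcommands
    are dominated by the power for the deepest one. *)
Lemma time_bound_poly W c : time_bound W c <= 3 * cmd_size c * W.+1 ^ depth c.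
Proof.
elim: c => [|x e|a e1 e2|c1 IH1 c2 IH2|e c1 IH1 c2 IH2|x e c IH];
  rewrite /= ?expn0 ?muln1; try lia.
- have p1 : W.+1 ^ depth c1 <= W.+1 ^ maxn (depth c1) (depth c2) by rewrite leq_pexp2l ?leq_maxl.
  have p2 : W.+1 ^ depth c2 <= W.+1 ^ maxn (depth c1) (depth c2) by rewrite leq_pexp2l ?leq_maxr.
  nia.
- have p1 : W.+1 ^ depth c1 <= W.+1 ^ maxn (depth c1) (depth c2) by rewrite leq_pexp2l ?leq_maxl.
  have p2 : W.+1 ^ depth c2 <= W.+1 ^ maxn (depth c1) (depth c2) by rewrite leq_pexp2l ?leq_maxr.
  have p3 : 0 < W.+1 ^ depth c1 by rewrite expn_gt0.
  nia.
- have p3 : 0 < W.+1 ^ depth c by rewrite expn_gt0.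
  rewrite expnS; set P := _ ^ _ in IH p3 *; set z := size _; set y := cmd_size c in IH *.
  have -> : 3 * (z + 2 + 4 + y + 3) * (W.+1 * P) = 
     3 * (z + 9) * (W.+1 * P) + W.+1 * (3 * y * P) by nia.
  have : W.+1 <= W.+1 * P by rewrite leq_pmulr.
  move: (W.+1 * P) => WP h.
  have : W * time_bound W c <= W.+1 * (3 * y * P) by apply: leq_mul => //.
  nia.
Qed.

Lemma size_compile d off c : size (compile d off c) = cmd_size c.
Proof.
elim: c d off => [|x e|a e1 e2|c1 IH1 c2 IH2|e c1 IH1 c2 IH2|x e c IH] d off //=;
  do ?rewrite ?size_cat ?size_address_code ?IH1 ?IH2 ?IH /=; lia.
Qed.

(** * Simulation of the loop language by the RAM *)

Definition code_at (prog : seq instr) (off : nat) (code : seq instr) :=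
  forall k, k < size code -> nth IHalt prog (off + k) = nth IHalt code k.

Lemma code_at_catl prog off c1 c2 :
  code_at prog off (c1 ++ c2) -> code_at prog off c1.
Proof.
move=> h k hk; rewrite h ?nth_cat ?hk //; rewrite size_cat; lia.
Qed.

Lemma code_at_catr prog off c1 c2 :
  code_at prog off (c1 ++ c2) -> code_at prog (off + size c1) c2.
Proof.
move=> h k hk; rewrite -addnA h ?size_cat ?ltn_add2l // nth_cat.
by rewrite ltnNge leq_addr /= addKn.
Qed.

Lemma code_at_head prog off i c : code_at prog off (i :: c) -> nth IHalt prog off = i.
Proof. by move=> /(_ 0 isT); rewrite addn0. Qed.

Lemma code_at_behead prog off i c : code_at prog off (i :: c) -> code_at prog off.+1 c.
Proof. by move=> h k hk; have := h k.+1 hk; rewrite addnS. Qed.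

Section Simulation.
Variables (inp : seq nat) (prog : seq instr).

Definition reaches (k : nat) (st st' : rstate) := iter k (step prog inp) st = st'.

Lemma reaches_trans k1 k2 a b c :
  reaches k1 a b -> reaches k2 b c -> reaches (k1 + k2) a c.
Proof. by rewrite /reaches addnC iterD => -> . Qed.

Lemma reaches_step off i mem st' :
  nth IHalt prog off = i ->
  (match i with
   | ILoad r c => RSt off.+1 (upd mem r c)
   | IAdd r a b => RSt off.+1 (upd mem r (mem a + mem b))
   | ISub r a b => RSt off.+1 (upd mem r (mem a - mem b))
   | IRead r a => RSt off.+1 (upd mem r (mem (mem a)))
   | IWrite a b => RSt off.+1 (upd mem (mem a) (mem b))
   | IIn r a => RSt off.+1 (upd mem r (nth 0 inp (mem a)))
   | IJz a t => RSt (if mem a == 0 then t else off.+1) mem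
   | IJmp t => RSt t mem
   | IHalt => RSt off mem
   end) = st' -> reaches 1 (RSt off mem) st'.
Proof. by move=> <- <-; rewrite /reaches /= /step; case: nth. Qed.

(** Only the temporaries from [r] to 63 may differ: operands held below [r] survive, and for
    [r >= 49] so does everything that represents the store. *)
Definition agree (r : nat) (mem mem' : nat -> nat) :=
  forall a, (a < r) || (64 <= a) -> mem' a = mem a.

Lemma agree_represents s r mem mem' :
  49 <= r -> agree r mem mem' -> represents s mem -> represents s mem'.
Proof.
move=> hr h [h1 h2 h3]; split=> [x hx|a i ha|]; rewrite h //; first exact: h1; try lia.
exact: h2.
Qed.

Lemma address_code_correct r a off mem :
  r < 63 -> code_at prog off (address_code r a) ->
  exists mem', [/\ reaches 5 (RSt off mem) (RSt (off + 5) mem'),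
                   mem' r = 64 + 8 * mem r + a & agree r mem mem'].
Proof.
move=> hr q0.
have q1 := code_at_behead q0; have q2 := code_at_behead q1.
have q3 := code_at_behead q2; have q4 := code_at_behead q3.
have [m1 [p1 e1 a1]] : exists m1, [/\ reaches 1 (RSt off mem) (RSt off.+1 m1),
    m1 r = mem r + mem r & agree r mem m1].
  exists (upd mem r (mem r + mem r)); split.
  - by apply: reaches_step (code_at_head q0) _.
  - by rewrite /upd eqxx.
  - by move=> x hx; rewrite /upd; case: eqP => // ?; lia.
have [m2 [p2 e2 a2]] : exists m2, [/\ reaches 1 (RSt off.+1 m1) (RSt off.+2 m2),
    m2 r = m1 r + m1 r & agree r m1 m2].
  exists (upd m1 r (m1 r + m1 r)); split.
  - by apply: reaches_step (code_at_head q1) _.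
  - by rewrite /upd eqxx.
  - by move=> x hx; rewrite /upd; case: eqP => // ?; lia.
have [m3 [p3 e3 a3]] : exists m3, [/\ reaches 1 (RSt off.+2 m2) (RSt off.+3 m3),
    m3 r = m2 r + m2 r & agree r m2 m3].
  exists (upd m2 r (m2 r + m2 r)); split.
  - by apply: reaches_step (code_at_head q2) _.
  - by rewrite /upd eqxx.
  - by move=> x hx; rewrite /upd; case: eqP => // ?; lia.
pose m4 := upd m3 r.+1 (64 + a).
have p4 : reaches 1 (RSt off.+3 m3) (RSt off.+4 m4).
  by apply: reaches_step (code_at_head q3) _.
exists (upd m4 r (m4 r + m4 r.+1)); split.
- rewrite (_ : off + 5 = off.+1.+4); last lia.
  have p5 : reaches 1 (RSt off.+4 m4) (RSt off.+1.+4 (upd m4 r (m4 r + m4 r.+1))).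
    by apply: reaches_step (code_at_head q4) _.
  exact: reaches_trans (reaches_trans (reaches_trans (reaches_trans p1 p2) p3) p4) p5.
- rewrite /upd eqxx /m4 /upd eqxx; case: eqP => [|_]; lia.
- move=> x hx; rewrite /upd /m4 /upd; case: eqP => [?|_]; first lia.
  case: eqP => [?|_]; first lia.
  by rewrite a3 ?a2 ?a1.
Qed.

Lemma compile_expr_correct e r off mem s :
  wf_expr e r -> code_at prog off (compile_expr e r) -> represents s mem ->
  exists mem', [/\ reaches (size (compile_expr e r)) (RSt off mem)
                     (RSt (off + size (compile_expr e r)) mem'),
                   mem' r = eval inp e s & agree r mem mem'].
Proof.
elim: e r off mem => [c|x|a IHa b IHb|a IHa b IHb|a IHa|j e IH] r off mem /= /andP[hr].
- move=> _ hc _; exists (upd mem r c); split.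
  + by rewrite /reaches /= /step /= (code_at_head hc) addn1.
  + by rewrite /upd eqxx.
  + by move=> a ha; rewrite /upd; case: eqP => // ?; lia.
- move=> hx hc [h1 h2 h3]; exists (upd mem r (mem x + mem 48)); split.
  + by rewrite /reaches /= /step /= (code_at_head hc) addn1.
  + by rewrite /upd eqxx h3 addn0 h1.
  + by move=> a ha; rewrite /upd; case: eqP => // ?; lia.
- move=> /andP[wa wb] hc hs.
  have [m1 [r1 e1 a1]] := IHa _ _ _ wa (code_at_catl hc) hs.
  have hc' := code_at_catr hc.
  have hs1 : represents s m1 by apply: agree_represents a1 hs; lia.
  have [m2 [r2 e2 a2]] := IHb _ _ _ wb (code_at_catl hc') hs1.
  have hc'' := code_at_catr hc'.
  exists (upd m2 r (m2 r + m2 r.+1)); split.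
  + rewrite !size_cat /= !addnA; apply: reaches_trans (reaches_trans r1 r2) _.
    by rewrite /reaches /= /step /= (code_at_head hc'') addn1.
  + by rewrite /upd eqxx e2 a2 ?e1 //; lia.
  + move=> x hx; rewrite /upd; case: eqP => [?|_]; first lia.
    by rewrite a2 ?a1 //; lia.
- move=> /andP[wa wb] hc hs.
  have [m1 [r1 e1 a1]] := IHa _ _ _ wa (code_at_catl hc) hs.
  have hc' := code_at_catr hc.
  have hs1 : represents s m1 by apply: agree_represents a1 hs; lia.
  have [m2 [r2 e2 a2]] := IHb _ _ _ wb (code_at_catl hc') hs1.
  have hc'' := code_at_catr hc'.
  exists (upd m2 r (m2 r - m2 r.+1)); split.
  + rewrite !size_cat /= !addnA; apply: reaches_trans (reaches_trans r1 r2) _.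
    by rewrite /reaches /= /step /= (code_at_head hc'') addn1.
  + by rewrite /upd eqxx e2 a2 ?e1 //; lia.
  + move=> x hx; rewrite /upd; case: eqP => [?|_]; first lia.
    by rewrite a2 ?a1 //; lia.
- move=> wa hc hs.
  have [m1 [r1 e1 a1]] := IHa _ _ _ wa (code_at_catl hc) hs.
  have hc' := code_at_catr hc.
  exists (upd m1 r (nth 0 inp (m1 r))); split.
  + rewrite !size_cat /= !addnA; apply: reaches_trans r1 _.
    by rewrite /reaches /= /step /= (code_at_head hc') addn1.
  + by rewrite /upd eqxx e1.
  + move=> x hx; rewrite /upd; case: eqP => [?|_]; first lia.
    by rewrite a1 //; lia.
- move=> /andP[hj wa] hc hs.
  have [m1 [r1 e1 a1]] := IH _ _ _ wa (code_at_catl hc) hs.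
  have hs1 : represents s m1 by apply: agree_represents a1 hs; lia.
  have q : code_at prog _ (address_code r j ++ [:: IRead r r]) := code_at_catr hc.
  have hr' : r < 63 by case/andP: hr.
  have [m2 [r2 e2 a2]] := address_code_correct m1 hr' (code_at_catl q).
  have q' := code_at_catr q.
  exists (upd m2 r (m2 (m2 r))); split.
  + rewrite size_cat addnA; apply: reaches_trans r1 (reaches_trans r2 _).
    by apply: reaches_step (code_at_head q') _; congr RSt; rewrite /=; lia.
  + rewrite /upd eqxx e2 e1 a2; last lia.
    by case: hs1 => _ -> .
  + move=> x hx; rewrite /upd; case: eqP => [?|_]; first lia.
    by rewrite a2 ?a1 //; lia.
Qed.

Lemma represents_temp s mem r v :
  49 <= r < 64 -> represents s mem -> represents s (upd mem r v).
Proof.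
move=> hr; apply: (@agree_represents _ 49) => // a ha.
by rewrite /upd; case: eqP => // ?; lia.
Qed.

Lemma represents_counter s mem r v :
  32 <= r < 48 -> represents s mem -> represents s (upd mem r v).
Proof.
move=> hr [h1 h2 h3]; split=> [x hx|a i ha|]; rewrite /upd; case: eqP => [?|_]; try lia; auto.
Qed.

Lemma represents_set_var s mem x v :
  x < 32 -> represents s mem -> represents (set_var s x v) (upd mem x v).
Proof.
move=> hr [h1 h2 h3]; split=> [y hy|a i ha|] /=; rewrite /upd;
  case: eqP => [?|_]; try lia; auto.
Qed.

Lemma represents_set_arr s mem a i v :
  a < 8 -> represents s mem ->
  represents (set_arr s a i v) (upd mem (64 + 8 * i + a) v).
Proof.
move=> ha [h1 h2 h3]; split=> [y hy|b i' hb|] /=; rewrite /upd.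
- by case: eqP => [?|_]; [lia|auto].
- case: (b =P a) => [->|ne].
    case: (i' =P i) => [->|ne]; first by rewrite eqxx.
    by case: eqP => [?|_]; [lia|auto].
  by case: eqP => [?|_]; [lia|auto].
- by case: eqP => [?|_]; [lia|auto].
Qed.

Definition same_counters d (mem mem' : nat -> nat) :=
  forall h, 32 <= h < 32 + 2 * d -> mem' h = mem h.

(** The clause [same_counters d] protects the control registers of the enclosing loops; without it
    the induction would not pass through a loop body. *)
Lemma compile_correct W c d off s mem :
  wf_cmd d c -> code_at prog off (compile d off c) -> represents s mem ->
  loops_le inp W c s -> d <= 8 ->
  exists mem' k, [/\ k <= time_bound W c,
    reaches k (RSt off mem) (RSt (off + cmd_size c) mem'),
    represents (exec inp c s) mem' & same_counters d mem mem'].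
Proof.
elim: c d off s mem => [|x e|a e1 e2|c1 IH1 c2 IH2|e c1 IH1 c2 IH2|x e c IH]
  d off s mem.
- by move=> _ _ hs _ _; exists mem, 0; split=> //; rewrite addn0.
- move=> /= /andP[hx we] hc hs _ hd.
  have [m1 [r1 v1 a1]] := compile_expr_correct we (code_at_catl hc) hs.
  have hs1 := agree_represents (leqnn _) a1 hs.
  have q := code_at_head (code_at_catr hc).
  exists (upd m1 x (m1 49 + m1 48)), (size (compile_expr e 49) + 1); split=> //.
  + apply: reaches_trans r1 _.
    by rewrite /reaches /= /step /= q addnA addn1.
  + have [_ _ ->] := hs1; rewrite addn0 v1; exact: represents_set_var.
  + move=> h hh; rewrite /upd; case: eqP => [?|_]; first lia.
    by rewrite a1 //; lia.
- move=> /= /and3P[ha w1 w2] hc hs _ hd.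
  have [m1 [r1 v1 a1]] := compile_expr_correct w1 (code_at_catl hc) hs.
  have hs1 := agree_represents (leqnn _) a1 hs.
  have q : code_at prog (off + size (compile_expr e1 49))
      (address_code 49 a ++ compile_expr e2 50 ++ [:: IWrite 49 50]) := code_at_catr hc.
  have [m6 [r6 hm6 a6]] := address_code_correct m1 (isT : 49 < 63) (code_at_catl q).
  have hs6 := agree_represents (leqnn _) a6 hs1.
  have q5 := code_at_catr q.
  have [m7 [r7 v7 a7]] := compile_expr_correct w2 (code_at_catl q5) hs6.
  have hs7 := agree_represents (isT : 49 <= 50) a7 hs6.
  have q7 := code_at_head (code_at_catr q5).
  exists (upd m7 (m7 49) (m7 50)), (size (compile_expr e1 49) + 5 + size (compile_expr e2 50) + 1).
  split=> //.
  + apply: reaches_trans (reaches_trans (reaches_trans r1 r6) r7) _.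
    by apply: reaches_step q7 _; rewrite size_address_code; congr RSt; lia.
  + rewrite a7 // hm6 v1 v7; exact: represents_set_arr.
  + move=> h hh; rewrite a7 // hm6 /upd; case: eqP => [?|_]; first lia.
    by rewrite a7 ?a6 ?a1 //; lia.
- move=> /= /andP[w1 w2] hc hs [l1 l2] hd.
  have [m1 [k1 [t1 r1 hs1 sc1]]] := IH1 _ _ _ _ w1 (code_at_catl hc) hs l1 hd.
  have hc2 := code_at_catr hc; rewrite size_compile in hc2.
  have [m2 [k2 [t2 r2 hs2 sc2]]] := IH2 _ _ _ _ w2 hc2 hs1 l2 hd.
  exists m2, (k1 + k2); split=> //; first lia.
  + by rewrite addnA; apply: reaches_trans r1 r2.
  + by move=> h hh; rewrite sc2 ?sc1.
- move=> /= /and3P[we w1 w2] hc hs hl hd.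
  have [m1 [r1 v1 a1]] := compile_expr_correct we (code_at_catl hc) hs.
  have hs1 := agree_represents (leqnn _) a1 hs.
  have q0 := code_at_catr hc; have q1 := code_at_behead q0.
  have q2 := code_at_catr q1; rewrite size_compile in q2.
  have q3 := code_at_behead q2.
  set o := off + _ in q0 q1 q2 q3 r1.
  rewrite -[o.+1]addn1 in q1 q2 q3; rewrite -[(o + 1 + _).+1]addn1 in q3.
  have sc1 : same_counters d mem m1 by move=> h hh; rewrite a1 //; lia.
  move: hl; case: eqP => hv hl.
  + have [m2 [k2 [t2 r2 hs2 sc2]]] := IH2 _ _ _ _ w2 q3 hs1 hl hd.
    exists m2, (size (compile_expr e 49) + 1 + k2); split=> //; first lia.
    * have p : reaches 1 (RSt o m1) (RSt (o + 1 + cmd_size c1 + 1) m1).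
        by apply: reaches_step (code_at_head q0) _; rewrite v1 hv eqxx.
      have := reaches_trans (reaches_trans r1 p) r2.
      rewrite (_ : o + 1 + cmd_size c1 + 1 + cmd_size c2 =
        off + (size (compile_expr e 49) + 1 + cmd_size c1 + 1 + cmd_size c2)) //.
      by rewrite /o; lia.
    * by move=> h hh; rewrite sc2 ?sc1.
  + have [m2 [k2 [t2 r2 hs2 sc2]]] := IH1 _ _ _ _ w1 (code_at_catl q1) hs1 hl hd.
    exists m2, (size (compile_expr e 49) + 1 + k2 + 1); split=> //; first lia.
    * have p : reaches 1 (RSt o m1) (RSt (o + 1) m1).
        by apply: reaches_step (code_at_head q0) _; rewrite v1 (introF eqP hv) addn1.
      apply: reaches_trans (reaches_trans (reaches_trans r1 p) r2) _.
      by apply: reaches_step (code_at_head q2) _; congr RSt; rewrite /o; lia.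
    * by move=> h hh; rewrite sc2 ?sc1.
- move=> /= /and4P[hx hd we w] hc hs [hW hl] _.
  have [m1 [r1 v1 a1]] := compile_expr_correct we (code_at_catl hc) hs.
  have hs1 := agree_represents (leqnn _) a1 hs.
  have sc1 : same_counters d mem m1 by move=> h hh; rewrite a1 //; lia.
  have q0 := code_at_catr hc; have q1 := code_at_behead q0.
  have q2 := code_at_behead q1; have q3 := code_at_behead q2.
  have q4 := code_at_behead q3; have q5 := code_at_behead q4.
  have q6 := code_at_behead q5.
  have q7 := code_at_catr q6; rewrite size_compile in q7.
  have q8 := code_at_behead q7; have q9 := code_at_behead q8.
  set o := off + _ in q0 q1 q2 q3 q4 q5 q6 q7 q8 q9 r1.
  set N := eval inp e s in v1 hW hl *.
  set hb := 32 + 2 * d in q0 q1 q2 q3 q4 q5 q6 q7 q8 q9.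
  set hk := 33 + 2 * d in q0 q1 q2 q3 q4 q5 q6 q7 q8 q9.
  set body := foldl _.
  pose m2 := upd (upd m1 hb (m1 49 + m1 48)) hk 0.
  have r2 : reaches 2 (RSt o m1) (RSt o.+2 m2).
    by apply: (@reaches_trans 1 1) (reaches_step (code_at_head q0) erefl) _;
      apply: reaches_step (code_at_head q1) _.
  (* Invariant at the loop head: one register counts the remaining rounds down, the other counts the
     finished rounds up. The body may overwrite [x] without disturbing them. *)
  have main j : j <= N -> exists mem' k, [/\ k <= j * (time_bound W c + 7),
      reaches k (RSt o.+2 m2) (RSt o.+2 mem'),
      represents (body s (iota 0 j)) mem', same_counters d mem mem' &
      mem' hb = N - j /\ mem' hk = j].
    elim: j => [|j IHj] hj.
      exists m2, 0; split=> //.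
      + rewrite /m2; apply: represents_counter; first by rewrite /hk; lia.
        by apply: represents_counter => //; rewrite /hb; lia.
      + move=> h hh; rewrite /m2 /upd /hb /hk.
        by do 2 (case: eqP => [?|_]; first lia); apply: sc1.
      + rewrite /m2 /upd !eqxx; split=> //.
        case: eqP => [|_]; first by rewrite /hb /hk; lia.
        by rewrite v1; case: hs1 => _ _ ->; lia.
    have [m3 [k3 [t3 r3 hs3 sc3 [b3 c3]]]] := IHj (ltnW hj).
    pose m4 := upd m3 49 1; pose m5 := upd m4 hb (m4 hb - m4 49).
    pose m6 := upd m5 x (m5 hk + m5 48).
    have zero : m5 48 = 0.
      rewrite /m5 /m4 /upd; case: eqP => [|_]; first by rewrite /hb; lia.
      by case: hs3.
    have m5k : m5 hk = j.
      rewrite /m5 /m4 /upd; case: eqP => [|_]; first by rewrite /hb /hk; lia.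
      by case: eqP => [|_] //; rewrite /hk; lia.
    have hs6 : represents (set_var (body s (iota 0 j)) x j) m6.
      rewrite /m6 zero m5k addn0; apply: represents_set_var => //.
      by apply: represents_counter; [rewrite /hb; lia|]; apply: represents_temp.
    have r6 : reaches 4 (RSt o.+2 m3) (RSt (o.+2 + 4) m6).
      have p2 : reaches 1 (RSt o.+2 m3) (RSt o.+3 m3).
        by apply: reaches_step (code_at_head q2) _; rewrite b3; case: eqP => [?|_] //; lia.
      have p3 : reaches 1 (RSt o.+3 m3) (RSt o.+4 m4) by apply: reaches_step (code_at_head q3) _.
      have p4 : reaches 1 (RSt o.+4 m4) (RSt o.+1.+4 m5) by apply: reaches_step (code_at_head q4) _.
      have p5 : reaches 1 (RSt o.+1.+4 m5) (RSt o.+2.+4 m6).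
        by apply: reaches_step (code_at_head q5) _.
      rewrite addn4; exact: reaches_trans (reaches_trans (reaches_trans p2 p3) p4) p5.
    have q6' : code_at prog (o.+2 + 4) (compile d.+1 (o.+2 + 4) c).
      by move: (code_at_catl q6); rewrite -[o.+2.+4]addn4 -[o.+2]addn2.
    have [m7 [k7 [t7 r7 hs7 sc7]]] := IH _ _ _ _ w q6' hs6 (hl _ hj) hd.
    pose m8 := upd m7 49 1; pose m9 := upd m8 hk (m8 hk + m8 49).
    have r9 : reaches 3 (RSt (o.+2 + 4 + cmd_size c) m7) (RSt o.+2 m9).
      move: q7 q8 q9; rewrite -[o.+2.+4]addn4 => q7 q8 q9.
      set o' := o.+2 + 4 + cmd_size c in q7 q8 q9 *.
      have p7 : reaches 1 (RSt o' m7) (RSt o'.+1 m8) by apply: reaches_step (code_at_head q7) _.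
      have p8 : reaches 1 (RSt o'.+1 m8) (RSt o'.+2 m9) by apply: reaches_step (code_at_head q8) _.
      have p9 : reaches 1 (RSt o'.+2 m9) (RSt o.+2 m9).
        by apply: reaches_step (code_at_head q9) _; rewrite addn2.
      exact: reaches_trans (reaches_trans p7 p8) p9.
    exists m9, (k3 + 4 + k7 + 3); split.
    + move: t3 t7; rewrite mulSn; lia.
    + by apply: reaches_trans (reaches_trans (reaches_trans r3 r6) r7) r9.
    + rewrite -addn1 iotaD /body foldl_cat /= -/body.
      by apply: represents_counter; [rewrite /hk; lia|]; apply: represents_temp.
    + move=> h hh; rewrite /m9 /m8 /upd /hk.
      case: eqP => [?|_]; first lia.
      case: eqP => [?|_]; first lia.
      rewrite sc7; last lia.
      rewrite /m6 /m5 /m4 /upd /hb.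
      do 3 (case: eqP => [?|_]; first lia).
      exact: sc3.
    (* The body was compiled at depth [d.+1], so its own frame covers both control registers of this
       loop. *)
    + have m7b : m7 hb = m6 hb by apply: sc7; rewrite /hb; lia.
      have m7k : m7 hk = m6 hk by apply: sc7; rewrite /hk; lia.
      have m6b : m6 hb = N - j.+1.
        rewrite /m6 /upd; case: eqP => [|_]; first by rewrite /hb; lia.
        rewrite /m5 /upd eqxx /m4 /upd eqxx.
        case: eqP => [|_]; first by rewrite /hb; lia.
        by rewrite b3; lia.
      have m6k : m6 hk = j.
        by rewrite /m6 /upd; case: eqP => [|_] //; rewrite /hk; lia.
      rewrite /m9 /m8 /upd !eqxx; split.
        case: eqP => [|_]; first by rewrite /hb /hk; lia.
        by case: eqP => [|_]; [rewrite /hb; lia|rewrite m7b m6b].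
      by case: eqP => [|_]; [rewrite /hk; lia|rewrite m7k m6k addn1].
  have [m3 [k3 [t3 r3 hs3 sc3 [b3 c3]]]] := main N (leqnn _).
  exists m3, (size (compile_expr e 49) + 2 + k3 + 1); split=> //.
  + have : N * (time_bound W c + 7) <= W * (time_bound W c + 7) by rewrite leq_mul2r hW orbT.
    lia.
  + apply: reaches_trans (reaches_trans (reaches_trans r1 r2) r3) _.
    rewrite /reaches /= /step /= (code_at_head q2) /= b3 subnn eqxx.
    by congr RSt; rewrite /o; lia.
Qed.

End Simulation.

(** Variable 0 lives in register 0, where the machine initially holds the input length. *)
Definition initial_store (inp : seq nat) :=
  Sto (fun x => if x == 0 then size inp else 0) (fun _ _ => 0).

Theorem compile_run W c inp :
  wf_cmd 0 c -> loops_le inp W c (initial_store inp) ->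
  exists j, [/\ j <= time_bound W c, halted (compile 0 0 c) (run (compile 0 0 c) inp j)
    & regs (run (compile 0 0 c) inp j) 0 = vars (exec inp c (initial_store inp)) 0].
Proof.
move=> wf hl.
have hs : represents (initial_store inp) (regs (init_state inp)).
  by split=> //= a i ha; rewrite addn_eq0.
have hc : code_at (compile 0 0 c) 0 (compile 0 0 c) by [].
have [m [k [hk r [h1 _ _] _]]] := compile_correct wf hc hs hl isT.
exists k; have -> : run (compile 0 0 c) inp k = RSt (0 + cmd_size c) m by exact: r.
split=> //; last exact: h1.
(* The program counter stands just past the code, where [nth] returns its default [IHalt]. *)
by rewrite /halted /= nth_default // size_compile.
Qed.

(** * Grouping vectors into few-element sums of constant sign *)

Section Grouping.
Import Order.TTheory GRing.Theory Num.Theory.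
Local Open Scope ring_scope.

(** Only 2B+1 values are possible for prefix sums, so two of the first 2B+2 coincide and the segment
    between them sums to zero. Cutting it out creates no new prefix sum, so the hypothesis
    survives. *)
Lemma zero_sum_segments (T : eqType) (v : T -> int) (B : nat) (p : seq T) :
  (forall k, `|\sum_(x <- take k p) v x| <= B%:Z) ->
  exists gs p0, [/\ perm_eq (flatten gs ++ p0) p,
    forall g, g \in gs -> (size g <= (2 * B).+1)%N /\ \sum_(x <- g) v x = 0
    & (size p0 <= (2 * B).+1)%N].
Proof.
have [N] := ubnP (size p); elim: N p => // N IH p hN hp.
have [small|big] := leqP (size p) (2 * B).+1; first by exists [::], p; split.
pose f k : int := \sum_(x <- take k p) v x.
(* Adding B makes the sums natural numbers below 2B+1, ready for pigeonhole. *)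
pose h := [seq absz (f k + B%:Z) | k <- iota 0 (2 * B).+2].
have [|] := boolP (uniq h).
  have sub : {subset h <= iota 0 (2 * B).+1}.
    move=> _ /mapP[k _ ->]; rewrite mem_iota /=; have := hp k; rewrite -/(f k); lia.
  by move=> /uniq_leq_size /(_ sub); rewrite size_map !size_iota ltnn.
move=> /(uniqPn 0%N)[i [j [ij jh]]].
rewrite size_map size_iota in jh.
have ih : (i < (2 * B).+2)%N by lia.
rewrite !(nth_map 0%N) ?size_iota // !nth_iota // !add0n => eqij.
have {eqij} fij : f i = f j by have := hp i; have := hp j; rewrite -/(f i) -/(f j); lia.
pose seg := drop i (take j p).
have tij : take j p = take i p ++ seg.
  by rewrite /seg -{1}(cat_take_drop i (take j p)) take_takel // ltnW.
have dec : p = take i p ++ seg ++ drop j p by rewrite catA -tij cat_take_drop.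
have ssz : size seg = (j - i)%N by rewrite size_drop size_takel //; lia.
have seg0 : \sum_(x <- seg) v x = 0.
  by move: fij; rewrite {2}/f tij big_cat /= -/(f i) => /eqP; rewrite -{1}[f i]addr0 => /eqP /addrI.
have [||gs [p0 [h1 h2 h3]]] := IH (take i p ++ drop j p).
- have : size p = (size (take i p) + (j - i) + size (drop j p))%N.
    by rewrite {1}dec !size_cat ssz addnA.
  rewrite size_cat; lia.
(* A prefix reaching past the cut has the same sum as the prefix of [p] with the segment put
   back. *)
- move=> k; rewrite take_cat size_takel; last lia.
  case: ltnP => hk; first by rewrite take_takel ?hp // ltnW.
  rewrite big_cat /= -/(f i) fij /f -big_cat /=.
  by have := hp (j + (k - i))%N; rewrite takeD.
exists (seg :: gs), p0; split=> //.
- rewrite /= -catA [X in perm_eq _ X]dec perm_sym perm_catCA perm_cat2l perm_sym; exact: h1.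
- move=> g; rewrite inE => /predU1P[->|/h2//]; split=> //; lia.
Qed.

(** Append a negative item while the sum is positive and a positive item otherwise. The sum never
    leaves [-B, B], and the process stops only when all remaining items share the sign of the
    sum. *)
Lemma greedy_prefixes (T : eqType) (v : T -> int) (B : nat) (s : seq T) :
  (forall x, x \in s -> `|v x| <= B%:Z) ->
  exists p r, [/\ perm_eq (p ++ r) s, forall k, `|\sum_(x <- take k p) v x| <= B%:Z
    & (0 <= \sum_(x <- p) v x) && all (fun x => 0 <= v x) r ||
      (\sum_(x <- p) v x <= 0) && all (fun x => v x <= 0) r].
Proof.
move=> hs.
suff gen N p r : (size r < N)%N -> perm_eq (p ++ r) s ->
    (forall k, `|\sum_(x <- take k p) v x| <= B%:Z) ->
  exists p r, [/\ perm_eq (p ++ r) s, forall k, `|\sum_(x <- take k p) v x| <= B%:Z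
    & (0 <= \sum_(x <- p) v x) && all (fun x => 0 <= v x) r ||
      (\sum_(x <- p) v x <= 0) && all (fun x => v x <= 0) r].
  by apply: (gen (size s).+1 [::] s) => // k; rewrite big_nil.
elim: N p r => // N IH p r hN hpr hp.
have hsum : `|\sum_(x <- p) v x| <= B%:Z by rewrite -[p]take_size.
have step x : x \in r -> `|\sum_(y <- p) v y + v x| <= B%:Z ->
  exists p r, [/\ perm_eq (p ++ r) s, forall k, `|\sum_(x <- take k p) v x| <= B%:Z
    & (0 <= \sum_(x <- p) v x) && all (fun x => 0 <= v x) r ||
      (\sum_(x <- p) v x <= 0) && all (fun x => v x <= 0) r].
  move=> xr hx; apply: (IH (rcons p x) (rem x r)).
  - by rewrite size_rem //; case: (r) xr hN => //= *; lia.
  - rewrite cat_rcons (perm_trans _ hpr) // perm_cat2l perm_sym; exact: perm_to_rem.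
  - move=> k; rewrite -cats1 take_cat; case: ltnP => hk; first exact: hp.
    case: (k - size p)%N => [|q] /=; first by rewrite cats0.
    by rewrite big_cat big_seq1.
have vb x : x \in r -> `|v x| <= B%:Z.
  by move=> xr; apply: hs; rewrite -(perm_mem hpr) mem_cat xr orbT.
have [pos|npos] := ltP 0 (\sum_(x <- p) v x).
  have [al|/allPn[x xr hx]] := boolP (all (fun x => 0 <= v x) r).
    by exists p, r; split=> //; rewrite al ltW.
  by apply: (step x) => //; have := vb x xr; lia.
have [al|/allPn[x xr hx]] := boolP (all (fun x => v x <= 0) r).
  by exists p, r; split=> //; rewrite al npos /= orbT.
by apply: (step x) => //; have := vb x xr; lia.
Qed.

(** The groups are the zero-sum segments of the greedy prefix, its short leftover, and singletons.
    The leftover carries the whole sum of the prefix, hence the sign of the singletons. *)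
Lemma same_sign_groups (T : eqType) (v : T -> int) (B : nat) (s : seq T) :
  (forall x, x \in s -> `|v x| <= B%:Z) ->
  exists gs, [/\ perm_eq (flatten gs) s,
    forall g, g \in gs -> (size g <= (2 * B).+1)%N
    & (forall g, g \in gs -> 0 <= \sum_(x <- g) v x) \/
      (forall g, g \in gs -> \sum_(x <- g) v x <= 0)].
Proof.
move=> /greedy_prefixes[p [r [h1 h2 h3]]].
have [zs [p0 [z1 z2 z3]]] := zero_sum_segments h2.
have flat1 : flatten [seq [:: x] | x <- r] = r by exact: flatten_seq1.
have sump : \sum_(x <- p) v x = \sum_(x <- p0) v x.
  rewrite -(perm_big _ z1) big_cat /= big_flatten big1_seq ?add0r // => g /andP[_ /z2[]//].
exists (zs ++ p0 :: [seq [:: x] | x <- r]); split.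
- rewrite flatten_cat /= flat1 catA (perm_trans _ h1) // perm_cat2r; exact: z1.
- move=> g; rewrite mem_cat inE => /or3P[/z2[]//|/eqP->//|/mapP[x _ ->]//].
- have sum1 x : \sum_(y <- [:: x]) v y = v x by rewrite big_seq1.
  case/orP: h3 => /andP[s1 /allP s2]; [left|right] => g; rewrite mem_cat inE;
    by move=> /or3P[/z2[_ ->//]|/eqP->|/mapP[x xr ->]]; rewrite -?sump ?sum1 // s2.
Qed.

(* One more coordinate merges at most [2 B + 1] groups of size [B]. *)
Fixpoint group_bound (d : nat) : nat :=
  if d is d'.+1 then (2 * group_bound d').+1 * group_bound d' else 1.

Lemma sum_bound (T : eqType) (v : T -> int) (g : seq T) :
  (forall x, x \in g -> `|v x| <= 1) -> `|\sum_(x <- g) v x| <= (size g)%:Z.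
Proof.
elim: g => [|x g IH] h; first by rewrite big_nil.
rewrite big_cons /= -add1n PoszD; apply: le_trans (ler_normD _ _) (lerD _ _).
  by apply: h; rewrite mem_head.
by apply: IH => y yg; apply: h; rewrite inE yg orbT.
Qed.

(* Coordinates are handled one at a time: the sums of the groups that suit   *)
(* the previous coordinates are bounded integers in the next one, and are    *)
(* grouped again by [same_sign_groups].                                      *)
Lemma sign_coherent_groups (T C : eqType) (w : C -> T -> int) (cs : seq C) (s : seq T) :
  (forall c x, c \in cs -> x \in s -> `|w c x| <= 1) ->
  exists gs, [/\ perm_eq (flatten gs) s,
    forall g, g \in gs -> (size g <= group_bound (size cs))%N
    & forall c, c \in cs -> (forall g, g \in gs -> 0 <= \sum_(x <- g) w c x) \/
                            (forall g, g \in gs -> \sum_(x <- g) w c x <= 0)].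
Proof.
elim: cs => [|c cs IH] h.
  exists [seq [:: x] | x <- s]; split=> //; first by rewrite flatten_seq1.
  by move=> g /mapP[x _ ->].
have [c' x hc hx|gs [h1 h2 h3]] := IH; first by apply: h => //; rewrite inE hc orbT.
pose B := group_bound (size cs).
have [|hs [k1 k2 k3]] := @same_sign_groups _ (fun g => \sum_(x <- g) w c x) B gs.
  move=> g gg; apply: le_trans (sum_bound _) _; last by have := h2 g gg; rewrite -/B; lia.
  move=> x xg; apply: h; rewrite ?mem_head // -(perm_mem h1).
  by apply/flattenP; exists g.
have hg g : g \in hs -> {subset g <= gs}.
  by move=> gh x xg; rewrite -(perm_mem k1); apply/flattenP; exists g.
have flat2 : flatten [seq flatten g | g <- hs] = flatten (flatten hs).
  by elim: (hs) => //= g ? ->; rewrite flatten_cat.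
exists [seq flatten g | g <- hs]; split.
- by rewrite flat2; apply: perm_trans h1; apply: perm_flatten.
- move=> _ /mapP[g gh ->]; rewrite /= size_flatten.
  apply: (@leq_trans (size g * B)); last by rewrite leq_mul2r k2 ?orbT.
  move: (hg g gh); elim: (g) => //= x g' IHg sub; rewrite mulSn leq_add //.
    by apply: h2; apply: sub; rewrite mem_head.
  by apply: IHg => y yg; apply: sub; rewrite inE yg orbT.
- move=> c'; rewrite inE => /predU1P[->|c'cs].
    by case: k3 => k3; [left|right] => _ /mapP[g gh ->]; rewrite big_flatten; apply: k3.
  (* Merging groups keeps the sign already achieved in an earlier coordinate. *)
  case: (h3 _ c'cs) => hs3; [left|right] => _ /mapP[g gh ->]; rewrite big_flatten big_seq.
    by apply: sumr_ge0 => x xg; apply: hs3; apply: hg xg.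
  by apply: sumr_le0 => x xg; apply: hs3; apply: hg xg.
Qed.
End Grouping.

(** * The improvement step *)

Lemma ltn_sum_seq (T : eqType) (r : seq T) (F G : T -> nat) (x0 : T) :
  (forall x, x \in r -> F x <= G x) -> x0 \in r -> F x0 < G x0 ->
  \sum_(x <- r) F x < \sum_(x <- r) G x.
Proof.
move=> le x0r lt; rewrite !(big_rem x0 x0r) /= -addSn leq_add // big_seq [X in _ <= X]big_seq.
by apply: leq_sum => x /mem_rem; apply: le.
Qed.

(** * Outcomes, disapproval counts and the total violation *)

Section Outcomes.
(* Outcomes are functions on the naturals of which only the first [l] values  *)
(* matter; [b i k p] tells whether agent [i] disapproves of [p] at step [k],  *)
(* and the [j]-th constraint is [(tm j, lam j)].                              *)
Variables (n l m tau : nat) (b : nat -> nat -> nat -> nat) (tm lam : nat -> nat).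
Hypothesis b_le1 : forall i k p, i < n -> k < l -> p < m -> b i k p <= 1.

Definition valid (o : nat -> nat) := forall k, k < l -> o k < m.

(** The cutoff at [t] sits in the summand, so that all coordinates are sums over the same range of
    timesteps. *)
Definition cell i t k p := if k < t then b i k p else 0.

Definition dis (o : nat -> nat) i t := \sum_(0 <= k < l) cell i t k (o k).

Definition viol (o : nat -> nat) :=
  \sum_(0 <= j < tau) \sum_(0 <= i < n) (dis o i (tm j) - lam j).

Definition hamming (o o' : nat -> nat) := \sum_(0 <= k < l) (o k != o' k).

Lemma cellE i t k p : cell i t k p = if k < t then b i k p else 0.
Proof. by []. Qed.

Lemma disE o i t : dis o i t = \sum_(0 <= k < l) cell i t k (o k).
Proof. by []. Qed.

Lemma cell_le1 i t k p : i < n -> k < l -> p < m -> cell i t k p <= 1.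
Proof. by move=> hi hk hp; rewrite /cell; case: ifP => // _; apply: b_le1. Qed.

Lemma eq_dis o o' i t : (forall k, k < l -> o k = o' k) -> dis o i t = dis o' i t.
Proof. by move=> h; apply: eq_big_nat => k /h ->. Qed.

Lemma eq_viol o o' :
  (forall j i, j < tau -> i < n -> dis o i (tm j) = dis o' i (tm j)) -> viol o = viol o'.
Proof.
move=> h; apply: eq_big_nat => j /andP[_ hj]; apply: eq_big_nat => i /andP[_ hi].
by rewrite h.
Qed.

Lemma viol_eq0 o :
  viol o = 0 <-> forall j i, j < tau -> i < n -> dis o i (tm j) <= lam j.
Proof.
split=> [/eqP|h].
- rewrite sum_nat_seq_eq0 => /allP h j i hj hi.
  have := h j; rewrite mem_index_iota hj /= => /(_ isT).
  rewrite sum_nat_seq_eq0 => /allP /(_ i).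
  by rewrite mem_index_iota hi /= => /(_ isT); rewrite subn_eq0.
- rewrite /viol big1_seq // => j; rewrite mem_index_iota /= => hj.
  rewrite big1_seq // => i; rewrite mem_index_iota /= => hi.
  by apply/eqP; rewrite subn_eq0 h.
Qed.

Lemma dis_le o i t : valid o -> i < n -> dis o i t <= l.
Proof.
move=> v hi; rewrite /dis -[X in _ <= X]subn0 -[X in _ <= X]muln1 -sum_nat_const_nat.
by rewrite !big_nat; apply: leq_sum => k /andP[_ hk]; apply: cell_le1 => //; apply: v.
Qed.

Lemma viol_le o : valid o -> viol o <= tau * n * l.
Proof.
move=> v; rewrite -mulnA -{1}[tau]subn0 -sum_nat_const_nat /viol !big_nat.
apply: leq_sum => j _; rewrite -{2}[n]subn0 -sum_nat_const_nat !big_nat.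
apply: leq_sum => i /andP[_ hi]; apply: leq_trans (leq_subr _ _) _; exact: dis_le.
Qed.

(** A timestep moves a count by at most one; this is what places nearby outcomes inside the box. *)
Lemma dis_hamming o o' i t : valid o -> valid o' -> i < n ->
  dis o i t <= dis o' i t + hamming o o'.
Proof.
move=> v v' hi; rewrite /dis /hamming -big_split /= !big_nat; apply: leq_sum => k /andP[_ hk].
case: eqP => [->|_]; first by rewrite addn0.
by apply: leq_trans (cell_le1 _ hi hk (v _ hk)) _; apply: leq_addl.
Qed.

(** * Switching a group of timesteps towards a feasible outcome *)

Section Switch.
Import Order.TTheory GRing.Theory Num.Theory.
Local Open Scope ring_scope.

Definition gain (o o' : nat -> nat) (c : nat * nat) (k : nat) : int :=
  (cell c.2 (tm c.1) k (o' k))%:Z - (cell c.2 (tm c.1) k (o k))%:Z.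

Definition switch (g : seq nat) (o o' : nat -> nat) k := if k \in g then o' k else o k.

Lemma perm_switched (g : seq nat) : uniq g -> {subset g <= iota 0 l} ->
  perm_eq [seq k <- index_iota 0 l | k \in g] g.
Proof.
move=> ug sub; apply: uniq_perm => //; first by rewrite filter_uniq ?iota_uniq.
move=> k; rewrite mem_filter /index_iota subn0.
by case: (boolP (k \in g)) => //= /sub.
Qed.

Lemma dis_switch g o o' j i : uniq g -> {subset g <= iota 0 l} ->
  (dis (switch g o o') i (tm j))%:Z =
  (dis o i (tm j))%:Z + \sum_(k <- g) gain o o' (j, i) k.
Proof.
move=> ug sub; rewrite /dis !(big_morph Posz PoszD (erefl : Posz 0 = 0%R)).
rewrite -(perm_big _ (perm_switched ug sub)) big_filter [X in _ = _ + X]big_mkcond /= -big_split /=.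
apply: eq_bigr => k _; rewrite /switch /gain /=; case: ifP => _; last by rewrite addr0.
by rewrite addrC subrK.
Qed.

Lemma hamming_switch g o o' : uniq g -> {subset g <= iota 0 l} ->
  (hamming (switch g o o') o <= size g)%N.
Proof.
move=> ug sub; rewrite -(perm_size (perm_switched ug sub)) size_filter -sum1_count big_mkcond.
by apply: leq_sum => k _; rewrite /switch; case: ifP => _; [apply: leq_b1|rewrite eqxx].
Qed.

Lemma sum_sign_le (T : eqType) (gs : seq T) (S : T -> int) g : g \in gs ->
  (forall x, x \in gs -> 0 <= S x) -> S g <= \sum_(x <- gs) S x.
Proof.
move=> gg h; rewrite (big_rem g gg) /= lerDl big_seq.
by apply: sumr_ge0 => x /mem_rem; apply: h.
Qed.

(** The effects of all groups add up to the passage from [o] to [os], which lowers a violated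
    coordinate, so some group lowers it. Sign coherence makes this group harmless everywhere
    else. *)
Theorem improvement o os : valid o -> valid os -> viol os = 0%N -> (0 < viol o)%N ->
  exists o', [/\ valid o', (hamming o' o <= group_bound (tau * n))%N &
                 (viol o' < viol o)%N].
Proof.
move=> v vs /viol_eq0 hs.
pose cs := [seq (j, i) | j <- iota 0 tau, i <- iota 0 n].
have csP j i : ((j, i) \in cs) = (j < tau)%N && (i < n)%N.
  apply/allpairsP/andP => [[[j' i']] /= [h1 h2 [-> ->]]|[h1 h2]].
    by move: h1 h2; rewrite !mem_iota !add0n.
  by exists (j, i); rewrite /= !mem_iota !add0n.
have [/hasP[[j0 i0]]|/hasPn none] :=
    boolP (has (fun c => lam c.1 < dis o c.2 (tm c.1))%N cs); last first.
  move=> vpos; suff : viol o = 0%N by move=> z; rewrite z in vpos.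
  apply/viol_eq0 => j i hj hi; have := none (j, i); rewrite csP hj hi /= -leqNgt; exact.
rewrite csP /= => /andP[hj0 hi0] bad _.
pose s := [seq k <- iota 0 l | o k != os k].
have us : uniq s by rewrite filter_uniq ?iota_uniq.
have subs : {subset s <= iota 0 l} by apply: mem_subseq; apply: filter_subseq.
have ks k : k \in s -> (k < l)%N by move=> /subs; rewrite mem_iota.
have [|gs [h1 h2 h3]] := @sign_coherent_groups _ _ (gain o os) cs s.
  move=> [j i] k; rewrite csP => /andP[hj hi] /ks hk; rewrite /gain /=.
  by have := cell_le1 (tm j) hi hk (v _ hk); have := cell_le1 (tm j) hi hk (vs _ hk); lia.
(* Switching every differing timestep reproduces [os] on the first [l] timesteps. *)
have tot j i : (dis os i (tm j))%:Z =
    (dis o i (tm j))%:Z + \sum_(g <- gs) \sum_(k <- g) gain o os (j, i) k.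
  rewrite -big_flatten (perm_big _ h1) /= -(dis_switch _ _ _ _ us subs).
  congr Posz; apply: eq_dis => k hk; rewrite /switch mem_filter mem_iota hk /= andbT.
  by case: eqP.
have sz : size cs = (tau * n)%N by rewrite size_allpairs !size_iota.
have [g gg gneg] : exists2 g, g \in gs & \sum_(k <- g) gain o os (j0, i0) k < 0.
  apply/hasP; case: hasP => // none; have := hs _ _ hj0 hi0.
  suff : (dis o i0 (tm j0))%:Z <= (dis os i0 (tm j0))%:Z by lia.
  rewrite tot lerDl big_seq; apply: sumr_ge0 => g gg; rewrite leNgt.
  by apply/negP => hneg; apply: none; exists g.
have usg : uniq (flatten gs) by rewrite (perm_uniq h1).
have subg : {subset g <= iota 0 l}.
  by move=> k kg; apply: subs; rewrite -(perm_mem h1); apply/flattenP; exists g.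
have ug : uniq g.
  move: usg gg; elim: (gs) => //= g' gs' IH; rewrite cat_uniq inE => /and3P[u1 _ u2].
  by case/predU1P => [->|] //; apply: IH.
(* If all group sums are nonnegative here, one group stays at or below the value at [os], which
   respects the bound; otherwise the count does not rise. *)
have le j i : (j < tau)%N -> (i < n)%N ->
    (dis (switch g o os) i (tm j) - lam j <= dis o i (tm j) - lam j)%N.
  move=> hj hi; have hs' := hs _ _ hj hi; have := dis_switch o os j i ug subg.
  have /h3[hsg|hsg] : (j, i) \in cs by rewrite csP hj.
  - have : (dis o i (tm j))%:Z + \sum_(k <- g) gain o os (j, i) k <= (dis os i (tm j))%:Z.
      by rewrite tot lerD2l; apply: (sum_sign_le gg hsg).
    lia.
  - have := hsg g gg; lia.
exists (switch g o os); split.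
- by move=> k hk; rewrite /switch; case: ifP => _; [apply: vs|apply: v].
- by apply: leq_trans (hamming_switch _ _ ug subg) _; rewrite -sz; apply: h2.
- apply: (@ltn_sum_seq _ _ _ _ j0).
  + move=> j; rewrite mem_index_iota /= => hj; rewrite big_seq [X in (_ <= X)%N]big_seq.
    by apply: leq_sum => i; rewrite mem_index_iota /= => hi; apply: le.
  + by rewrite mem_index_iota.
  + apply: (@ltn_sum_seq _ _ _ _ i0).
    * by move=> i; rewrite mem_index_iota /= => hi; apply: le.
    * by rewrite mem_index_iota.
    (* The truncated difference is positive at a violated coordinate, so a smaller count strictly
       lowers it. *)
    * suff : (dis (switch g o os) i0 (tm j0))%:Z < (dis o i0 (tm j0))%:Z by lia.
      by rewrite dis_switch // gtrDl.
Qed.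
End Switch.
End Outcomes.

(** * Reasoning about programs *)

Fixpoint written_vars (c : cmd) : seq nat :=
  match c with
  | Skip | Store _ _ _ => [::]
  | Assign x _ => [:: x]
  | Seq c1 c2 | If _ c1 c2 => written_vars c1 ++ written_vars c2
  | For x _ c => x :: written_vars c
  end.

Fixpoint written_arrs (c : cmd) : seq nat :=
  match c with
  | Skip | Assign _ _ => [::]
  | Store a _ _ => [:: a]
  | Seq c1 c2 | If _ c1 c2 => written_arrs c1 ++ written_arrs c2
  | For _ _ c => written_arrs c
  end.

Definition framed (c : cmd) (s s' : store) :=
  (forall x, x \notin written_vars c -> vars s' x = vars s x) /\
  (forall a, a \notin written_arrs c -> arrs s' a = arrs s a).

Section Frames.
Variable inp : seq nat.
Local Notation exec := (exec inp).
Local Notation eval := (eval inp).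

Lemma framed_exec c s : framed c s (exec c s).
Proof.
elim: c s => [|x e|a e1 e2|c1 IH1 c2 IH2|e c1 IH1 c2 IH2|x e c IH] s.
- by [].
- by split=> //= y; rewrite inE /upd => /negPf ->.
- by split=> //= y; rewrite inE => /negPf ->.
- have [v1 a1] := IH1 s; have [v2 a2] := IH2 (exec c1 s).
  by split=> y /=; rewrite mem_cat negb_or => /andP[h1 h2];
    rewrite ?v2 ?a2 ?v1 ?a1.
- have [v1 a1] := IH1 s; have [v2 a2] := IH2 s.
  by split=> y /=; rewrite mem_cat negb_or => /andP[h1 h2]; case: ifP => _;
    rewrite ?v2 ?a2 ?v1 ?a1.
- rewrite /framed /=; move: (iota 0 (eval e s)) => ks; elim: ks s => //= k ks IHk s.
  have [v1 a1] := IHk (exec c (set_var s x k)).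
  have [v2 a2] := IH (set_var s x k).
  split=> y h; last by rewrite a1 // a2.
  rewrite v1 //; move: h; rewrite inE => /norP[/negPf yx yc].
  by rewrite v2 //= /upd yx.
Qed.

(** Intermediate states come with the frame of the whole loop, so an invariant need only mention
    what the loop changes. *)
Lemma for_ind (I : nat -> store -> Prop) x y c s :
  I 0 s ->
  (forall k s', k < vars s y -> framed (For x (Var y) c) s s' -> I k s' ->
     I k.+1 (exec c (set_var s' x k))) ->
  I (vars s y) (exec (For x (Var y) c) s).
Proof.
move=> h0 hS.
pose body j := foldl (fun s k => exec c (set_var s x k)) s (iota 0 j).
suff main j : j <= vars s y -> framed (For x (Var y) c) s (body j) /\ I j (body j).
  by have [] := main _ (leqnn _).
elim: j => [|j IH] hj; first by split.
have [fr Ij] := IH (ltnW hj).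
have -> : body j.+1 = exec c (set_var (body j) x j).
  by rewrite /body -addn1 iotaD foldl_cat.
split; last exact: hS.
have [v1 a1] := framed_exec c (set_var (body j) x j).
case: fr => v2 a2; split=> z h; last by rewrite a1 // a2.
move: (h); rewrite inE => /norP[/negPf zx zc].
by rewrite v1 //= /upd zx v2.
Qed.

Lemma exec_seq c1 c2 s : exec (Seq c1 c2) s = exec c2 (exec c1 s).
Proof. by []. Qed.

Lemma exec_if e c1 c2 s :
  exec (If e c1 c2) s = if eval e s == 0 then exec c2 s else exec c1 s.
Proof. by []. Qed.

Lemma loops_le_if W e c1 c2 s :
  loops_le inp W (If e c1 c2) s =
  if eval e s == 0 then loops_le inp W c2 s else loops_le inp W c1 s.
Proof. by []. Qed.

(** A syntactic criterion: when all loop bounds are variables of [V] and none of these is written,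
    each nested loop sees the values present at the start. *)
Fixpoint fixed_bounds (V : seq nat) (c : cmd) : bool :=
  match c with
  | Seq c1 c2 | If _ c1 c2 => fixed_bounds V c1 && fixed_bounds V c2
  | For _ (Var y) c => (y \in V) && fixed_bounds V c
  | For _ _ _ => false
  | _ => true
  end.

Lemma fixed_bounds_loops_le V W c s :
  fixed_bounds V c -> all (fun y => y \notin written_vars c) V ->
  (forall y, y \in V -> vars s y <= W) -> loops_le inp W c s.
Proof.
elim: c s => [|x e|a e1 e2|c1 IH1 c2 IH2|e c1 IH1 c2 IH2|x e c IH] s //=.
- move=> /andP[f1 f2] /allP hV hs.
  have hV1 y : y \in V -> (y \notin written_vars c1) /\ (y \notin written_vars c2).
    by move=> /hV; rewrite mem_cat => /norP[].
  split; first by apply: IH1 => //; apply/allP => y /hV1[].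
  apply: IH2 => //; first by apply/allP => y /hV1[].
  by move=> y yV; have [v _] := framed_exec c1 s; rewrite v ?hs //; case: (hV1 _ yV).
- move=> /andP[f1 f2] /allP hV hs.
  have hV1 y : y \in V -> (y \notin written_vars c1) /\ (y \notin written_vars c2).
    by move=> /hV; rewrite mem_cat => /norP[].
  by case: ifP => _; [apply: IH2|apply: IH1] => //; apply/allP => y /hV1[].
- case: e => // z /andP[zV f] /allP hV hs; split; first exact: hs.
  have hV1 y : y \in V -> (y == x) = false /\ (y \notin written_vars c).
    by move=> /hV; rewrite inE => /norP[/negPf].
  move=> k _; apply: IH => //; first by apply/allP => y /hV1[].
  move=> y yV; rewrite /= /upd; case: (hV1 _ yV) => -> yc.
  suff -> : vars (foldl (fun s k => exec c (set_var s x k)) s (iota 0 k)) y = vars s y by apply: hs.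
  elim: (iota 0 k) s {hs} => //= j js IHj s; rewrite IHj.
  by have [v _] := framed_exec c (set_var s x j); rewrite v //= /upd; case: (hV1 _ yV) => ->.
Qed.

End Frames.

(** * The program *)

Notation "c1 ;; c2" := (Seq c1 c2) (at level 90, right associativity).
Notation "x <~ e" := (Assign x e) (at level 80).
Notation "$ x" := (Var x) (at level 5, x at level 1, format "$ x").
Notation "e1 :+ e2" := (Plus e1 e2) (at level 50, left associativity).
Notation "e1 :- e2" := (Minus e1 e2) (at level 50, left associativity).
Coercion Const : nat >-> expr.

Notation vAns := 0 (only parsing).
Notation vN := 1 (only parsing).
Notation vM := 2 (only parsing).
Notation vL := 3 (only parsing).
Notation vTau := 4 (only parsing).
Notation vG := 5 (only parsing).
Notation vB := 6 (only parsing).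
Notation vS := 7 (only parsing).
Notation vOff := 8 (only parsing).
Notation vD := 9 (only parsing).
Notation vU := 10 (only parsing).
Notation vRounds := 11 (only parsing).
Notation vBest := 12 (only parsing).
Notation vKey := 13 (only parsing).
Notation vViol := 14 (only parsing).
Notation vPos := 15 (only parsing).
Notation vT := 16 (only parsing).
Notation vLam := 17 (only parsing).
Notation vPtr := 18 (only parsing).
Notation vDis := 19 (only parsing).
Notation vDis0 := 20 (only parsing).
Notation vX := 21 (only parsing).
Notation vAcc := 22 (only parsing).
Notation vj := 23 (only parsing).
Notation vi := 24 (only parsing).
Notation vk := 25 (only parsing).
Notation vz := 26 (only parsing).
Notation ve := 27 (only parsing).
Notation vkk := 28 (only parsing).
Notation vp := 29 (only parsing).
Notation vq := 30 (only parsing).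
Notation vBase := 31 (only parsing).

Notation aO := 0 (only parsing).
Notation aC := 1 (only parsing).
Notation aTab := 2 (only parsing).
Notation aFull := 3 (only parsing).
Notation aBest := 4 (only parsing).

(** The factor [y] is the number of rounds, so keys and slot numbers are always passed as [w]. *)
Definition mul_into x y w := x <~ 0 ;; For vz $y (x <~ $x :+ $w).

Definition copy_block a1 e1 a2 e2 :=
  For vq $vL (Store a2 (e2 :+ $vq) (Arr a1 (e1 :+ $vq))).

(** The pointer advances by one row of [m] input bits per timestep. Rows of consecutive agents are
    adjacent, so it is reset only once per constraint. *)
Definition agent_step :=
  If ($vT :- $vk)
     (vDis <~ $vDis :+ Input ($vPtr :+ Arr aC $vk) ;;
      vDis0 <~ $vDis0 :+ Input ($vPtr :+ Arr aO $vk))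
     Skip ;;
  vPtr <~ $vPtr :+ $vM.

Definition eval_agent := vDis <~ 0 ;; vDis0 <~ 0 ;; For vk $vL agent_step.

(** [vX] becomes the difference from the current outcome, shifted by g and clamped to [0, 2g]; the
    key collects these digits by Horner's rule in base 2g+1. *)
Definition add_agent :=
  eval_agent ;;
  vViol <~ $vViol :+ ($vDis :- $vLam) ;;
  vX <~ ($vDis :+ $vG) :- $vDis0 ;;
  vX <~ $vX :- ($vX :- ($vG :+ $vG)) ;;
  mul_into vAcc vB vKey ;;
  vKey <~ $vAcc :+ $vX.

Definition add_constraint :=
  vT <~ Input $vPos ;; vLam <~ Input ($vPos :+ 1) ;;
  vPos <~ $vPos :+ 2 ;; vPtr <~ 3 ;;
  For vi $vN add_agent.

Definition eval_candidate :=
  vKey <~ 0 ;; vViol <~ 0 ;; vPos <~ $vOff ;; For vj $vTau add_constraint.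

(** A filled slot is never overwritten: inside the box, outcomes with one key have the same profile
    and are interchangeable. *)
Definition insert_candidate :=
  eval_candidate ;;
  If (Arr aFull $vKey) Skip
    (Store aFull $vKey 1 ;;
     mul_into vBase vL vKey ;;
     copy_block aC 0 aTab $vBase ;;
     If ($vBest :- $vViol)
       (vBest <~ $vViol ;; copy_block aC 0 aBest 0)
       Skip).

Definition extend_entry :=
  mul_into vBase vL ve ;;
  copy_block aTab $vBase aC 0 ;;
  Store aC $vkk $vp ;;
  insert_candidate.

Definition fill_entry := If (Arr aFull $ve) (For vp $vM extend_entry) Skip.

(* The table is extended in place: an entry created during step [k] may be   *)
(* extended again in the same step, which only overwrites its choice at [k]. *)
Definition fill_step := For ve $vS fill_entry.

(** The best outcome found so far becomes the centre of the box and the only initial table entry. *)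
Definition round :=
  copy_block aBest 0 aO 0 ;;
  copy_block aBest 0 aC 0 ;;
  For ve $vS (Store aFull $ve 0) ;;
  insert_candidate ;;
  For vkk $vL fill_step.

(** The search starts from the constant outcome 0. Its violation serves as the number of rounds,
    since a round gains at least one as long as improvement is possible. *)
Definition search_init :=
  For vq $vL (Store aBest $vq 0) ;;
  copy_block aBest 0 aO 0 ;;
  copy_block aBest 0 aC 0 ;;
  eval_candidate ;;
  vBest <~ $vViol ;; vRounds <~ $vViol.

Definition search_rounds := For vU $vRounds round.

Definition search := search_init ;; search_rounds ;; vAns <~ Const 1 :- $vBest.

Definition pow2_into x y := x <~ 1 ;; For vz $y (x <~ $x :+ $x).

Definition read_layout :=
  mul_into vAcc vL vM ;; mul_into vOff vN vAcc ;; vOff <~ $vOff :+ 3 ;;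
  vTau <~ Input $vOff ;; vOff <~ $vOff :+ 1.

Definition table_size_step := mul_into vAcc vB vS ;; vS <~ $vAcc.

Definition setup :=
  read_layout ;;
  mul_into vD vTau vN ;;
  pow2_into vU vD ;; vU <~ $vU :+ $vU ;;
  pow2_into vG vU ;; vB <~ $vG :+ $vG :+ 1 ;;
  vS <~ 1 ;; For vk $vD table_size_step.

(** Degenerate instances are answered directly. Once n, m and l are positive, each is at most the
    input length; otherwise m, for instance, could be far larger than the input. *)
Definition program :=
  (vN <~ Input 0 ;; vM <~ Input 1 ;; vL <~ Input 2) ;;
  If $vM
    (If $vN (If $vL (setup ;; search) (vAns <~ 1)) (vAns <~ 1))
    (vAns <~ Const 1 :- $vL).

(** Witnesses the computability of the parameter-dependent factor of the running time. *)
Definition time_program K :=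
  (vN <~ Input 0 ;; mul_into vM vN vN ;; vM <~ $vM :+ Const K) ;;
  pow2_into vU vM ;; pow2_into vAns vU.

(** * Keys of candidates *)

Section Keys.
Variables (n l tau : nat) (b : nat -> nat -> nat -> nat) (tm lam : nat -> nat) (g : nat).
Local Notation dis := (dis l b).

(** Truncated subtraction clamps at 0 from below, and [x - (x - (g + g))] is the minimum of [x] and
    2g. *)
Definition digit (O C : nat -> nat) (c : nat * nat) :=
  let x := dis C c.2 (tm c.1) + g - dis O c.2 (tm c.1) in x - (x - (g + g)).

Definition pack (ds : seq nat) := foldl (fun acc x => (g + g).+1 * acc + x) 0 ds.

Definition coordinates t := [seq (j, i) | j <- iota 0 t, i <- iota 0 n].

Definition key O C := pack (map (digit O C) (coordinates tau)).

Lemma pack_rcons ds x : pack (rcons ds x) = (g + g).+1 * pack ds + x.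
Proof. by rewrite /pack -cats1 foldl_cat. Qed.

Lemma pack_lt ds : all (fun x => x <= g + g) ds -> pack ds < (g + g).+1 ^ size ds.
Proof.
elim/last_ind: ds => // ds x IH; rewrite all_rcons size_rcons pack_rcons expnS => /andP[hx /IH].
by nia.
Qed.

Lemma pack_inj ds ds' : size ds = size ds' ->
  all (fun x => x <= g + g) ds -> all (fun x => x <= g + g) ds' ->
  pack ds = pack ds' -> ds = ds'.
Proof.
elim/last_ind: ds ds' => [|ds x IH] ds'; first by case: ds'.
case/lastP: ds' => [|ds' y]; first by rewrite size_rcons.
rewrite !size_rcons !all_rcons !pack_rcons => -[sz] /andP[hx hds] /andP[hy hds'] e.
have e1 : pack ds = pack ds'.
  have := congr1 (fun z => z %/ (g + g).+1) e.
  by rewrite ![_.+1 * _]mulnC !divnMDl // !divn_small // !addn0.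
by move: e; rewrite e1 => /addnI ->; rewrite (IH ds').
Qed.

Lemma digits_le O C cs : all (fun x => x <= g + g) (map (digit O C) cs).
Proof. by apply/allP => _ /mapP[c _ ->]; rewrite /digit /=; lia. Qed.

Lemma coordinatesP t j i : ((j, i) \in coordinates t) = (j < t) && (i < n).
Proof.
apply/allpairsP/andP => [[[j' i']] /= [h1 h2 [-> ->]]|[h1 h2]].
  by move: h1 h2; rewrite !mem_iota !add0n.
by exists (j, i); rewrite /= !mem_iota !add0n.
Qed.

Lemma size_coordinates t : size (coordinates t) = t * n.
Proof. by rewrite size_allpairs !size_iota. Qed.

Lemma coordinatesS t : coordinates t.+1 = coordinates t ++ [seq (t, i) | i <- iota 0 n].
Proof. by rewrite /coordinates -addn1 iotaD allpairs_cat /= cats0. Qed.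

Lemma key_lt O C : key O C < (g + g).+1 ^ (tau * n).
Proof. by rewrite -size_coordinates -(size_map (digit O C)); apply/pack_lt/digits_le. Qed.

Lemma eq_key O C C' : (forall k, k < l -> C k = C' k) -> key O C = key O C'.
Proof.
by move=> h; congr pack; apply: eq_map => c; rewrite /digit (eq_dis b _ _ h).
Qed.

(* Clamping loses nothing on candidates whose profile is strictly inside the box. *)
Lemma key_inj O C C' : key O C = key O C' ->
  (forall j i, j < tau -> i < n ->
     dis C' i (tm j) < dis O i (tm j) + g /\ dis O i (tm j) < dis C' i (tm j) + g) ->
  forall j i, j < tau -> i < n -> dis C i (tm j) = dis C' i (tm j).
Proof.
move=> /pack_inj e near j i hj hi.
have := e; rewrite !size_map !digits_le => /(_ erefl isT isT) /eq_in_map /(_ (j, i)).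
rewrite coordinatesP hj hi => /(_ isT); rewrite /digit /=.
have := near _ _ hj hi; lia.
Qed.

(** These hybrids are the partial solutions of the dynamic program; each is as close to [o] as [o']
    is. *)
Definition mix k (o' o : nat -> nat) q := if q < k then o' q else o q.

Lemma hamming_mix k o' o : hamming l (mix k o' o) o <= hamming l o' o.
Proof. by apply: leq_sum => q _; rewrite /mix; case: ifP => // _; rewrite eqxx. Qed.

(** The additive form avoids truncated subtraction. *)
Lemma dis_upd C k p i t : k < l ->
  dis (upd C k p) i t + cell b i t k (C k) = dis C i t + cell b i t k p.
Proof.
move=> hk; have kin : k \in index_iota 0 l by rewrite mem_index_iota.
have rest : \sum_(q <- rem k (index_iota 0 l)) cell b i t q (upd C k p q) =
            \sum_(q <- rem k (index_iota 0 l)) cell b i t q (C q).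
  apply: eq_big_seq => q; rewrite mem_rem_uniq ?iota_uniq // inE => /andP[/negPf h _].
  by rewrite /upd h.
rewrite !disE !(big_rem k kin) /= rest /upd eqxx addnAC [RHS]addnAC. by congr (_ + _); apply: addnC.
Qed.

Lemma dis_mixS k o' o i t : k < l ->
  dis (mix k.+1 o' o) i t = dis (upd (mix k o' o) k (o' k)) i t.
Proof.
move=> hk; apply: eq_dis => q _; rewrite /mix /upd ltnS leq_eqVlt.
by case: eqP => [->|].
Qed.

End Keys.

(** * Correctness of the program *)

Section Correctness.
Variables (inp : seq nat) (n m l tau g off : nat).
Local Notation exec := (exec inp).
Local Notation eval := (eval inp).

(** Mirrors the input layout: three sizes, then the bits by agent, timestep and project; [off] is
    where the constraint pairs start. *)
Definition input_bit i k p := nth 0 inp (3 + (i * l + k) * m + p).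
Definition input_time j := nth 0 inp (off + 2 * j).
Definition input_bound j := nth 0 inp (off + 2 * j + 1).

Local Notation tm := input_time.
Local Notation lam := input_bound.
Local Notation dis := (dis l input_bit).
Local Notation viol := (viol n l tau input_bit tm lam).
Local Notation valid := (valid l m).
Local Notation cell := (cell input_bit).
Local Notation digit := (digit l input_bit tm g).
Local Notation key := (key n l tau input_bit tm g).
Local Notation pack := (pack g).

Definition table_size := (g + g).+1 ^ (tau * n).

Definition base s :=
  [/\ vars s vN = n, vars s vM = m, vars s vL = l, vars s vTau = tau &
  [/\ vars s vG = g, vars s vB = (g + g).+1, vars s vS = table_size & vars s vOff = off]].

Lemma base_framed c s s' : framed c s s' ->
  all (fun x => x \notin written_vars c) (iota 1 8) -> base s -> base s'.
Proof.
case=> h _ /allP hc [h1 h2 h3 h4 [h5 h6 h7 h8]].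
by split; [..|split]; rewrite h ?hc.
Qed.

Lemma base_exec c s : all (fun x => x \notin written_vars c) (iota 1 8) ->
  base s -> base (exec c s).
Proof. by apply: base_framed; apply: framed_exec. Qed.

Lemma mul_into_correct (x y w : nat) s : x != y -> x != w -> x != vz -> w != vz ->
  vars (exec (mul_into x y w) s) x = vars s y * vars s w.
Proof.
move=> xy xw xz wz; rewrite /mul_into exec_seq; set s1 := exec _ s.
have v1 z : z != x -> vars s1 z = vars s z by rewrite /s1 /= /upd => /negPf ->.
rewrite -(v1 y) 1?eq_sym //.
apply: (for_ind (I := fun k s' => vars s' x = k * vars s w)).
  by rewrite /s1 /= /upd eqxx.
move=> k s' _ [fr _] IH; rewrite /= {1}/upd eqxx /upd (negPf xz) (negPf wz) IH.
rewrite fr ?v1 1?eq_sym // ?mulSn 1?addnC //= !inE negb_or wz eq_sym xw //.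
Qed.

Lemma copy_block_correct (a1 : nat) e1 (a2 : nat) e2 s :
  a1 != a2 -> vars s vL = l ->
  (forall s', (forall y, y != vq -> vars s' y = vars s y) ->
     eval e1 s' = eval e1 s /\ eval e2 s' = eval e2 s) ->
  let s' := exec (copy_block a1 e1 a2 e2) s in
  (forall q, q < l -> arrs s' a2 (eval e2 s + q) = arrs s a1 (eval e1 s + q)) /\
  (forall x, (x < eval e2 s) || (eval e2 s + l <= x) -> arrs s' a2 x = arrs s a2 x).
Proof.
move=> ne hl he; cbv zeta; rewrite /copy_block -hl.
apply: (for_ind (I := fun k s' =>
  (forall q, q < k -> arrs s' a2 (eval e2 s + q) = arrs s a1 (eval e1 s + q)) /\
  (forall x, (x < eval e2 s) || (eval e2 s + k <= x) -> arrs s' a2 x = arrs s a2 x))).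
  by split=> // x; case: ltnP.
move=> k s' hk [frv fra] [IH1 IH2].
have [E1 E2] : eval e1 (set_var s' vq k) = eval e1 s /\ eval e2 (set_var s' vq k) = eval e2 s.
  apply: he => y hy; rewrite /= /upd (negPf hy) frv //= !inE //.
rewrite /= {1}/upd eqxx E1 E2 /upd eqxx.
rewrite (fra a1) ?inE //.
split=> [q|x hx].
- rewrite ltnS leq_eqVlt eqn_add2l => /predU1P[->|hq]; first by rewrite eqxx.
  by case: eqP => [->//|_]; apply: IH1.
- case: eqP => [?|_]; first lia.
  by apply: IH2; lia.
Qed.

(** * Evaluating a candidate outcome *)

Lemma eval_agent_correct s i : base s -> vars s vPtr = 3 + i * l * m ->
  let s' := exec eval_agent s in
  [/\ vars s' vDis = dis (arrs s aC) i (vars s vT),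
      vars s' vDis0 = dis (arrs s aO) i (vars s vT) &
      vars s' vPtr = 3 + i.+1 * l * m].
Proof.
move=> hb hp; cbv zeta; rewrite /eval_agent !exec_seq; set s1 := exec (vDis0 <~ 0) _.
have [h1 h2 h3 h4 _] := hb.
have := @for_ind inp (fun k s' =>
  [/\ vars s' vDis = \sum_(0 <= q < k) cell i (vars s vT) q (arrs s aC q),
      vars s' vDis0 = \sum_(0 <= q < k) cell i (vars s vT) q (arrs s aO q) &
      vars s' vPtr = 3 + (i * l + k) * m]) vk vL agent_step s1.
rewrite (_ : vars s1 vL = l) // (_ : i * l + l = i.+1 * l) 1?mulSnr //; apply.
  by rewrite !big_geq // addn0; split.
move=> k s' hk [frv fra] [I1 I2 I3].
have VT : vars s' vT = vars s vT by rewrite frv.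
have VM : vars s' vM = m by rewrite frv // h2.
have A a : arrs s' a = arrs s a by rewrite fra.
rewrite !big_nat_recr //= -I1 -I2 !cellE /input_bit /upd /= VT subn_eq0 leqNgt.
by case: ltnP => hkt /=; rewrite /upd /= ?A I3 VM; split; rewrite ?addn0 //; lia.
Qed.

Lemma add_agent_correct s j i : base s -> vars s vPtr = 3 + i * l * m ->
  vars s vT = tm j -> vars s vLam = lam j ->
  let s' := exec add_agent s in
  [/\ vars s' vViol = vars s vViol + (dis (arrs s aC) i (tm j) - lam j),
      vars s' vKey = (g + g).+1 * vars s vKey + digit (arrs s aO) (arrs s aC) (j, i) &
      vars s' vPtr = 3 + i.+1 * l * m].
Proof.
move=> hb hp hT hL; cbv zeta; rewrite /add_agent exec_seq.
have [] := eval_agent_correct hb hp.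
have [] := framed_exec inp eval_agent s; set s1 := exec eval_agent s => frv _ e1 e2 e3.
have [_ _ _ _ [hg hB _ _]] := hb.
rewrite 3!exec_seq; set s2 := exec (vX <~ _) _.
rewrite exec_seq; have hK := @mul_into_correct vAcc vB vKey s2 isT isT isT isT.
have [] := framed_exec inp (mul_into vAcc vB vKey) s2.
set s3 := exec (mul_into _ _ _) _ in hK * => frv3 _.
have [f1 f2 f3 f4 f5] : [/\ vars s1 vViol = vars s vViol, vars s1 vKey = vars s vKey,
    vars s1 vG = g, vars s1 vB = (g + g).+1 & vars s1 vLam = lam j].
  by split; rewrite frv // hL.
have [k1 k2 k3] : [/\ vars s3 vViol = vars s2 vViol, vars s3 vX = vars s2 vX &
    vars s3 vPtr = vars s2 vPtr] by split; rewrite frv3.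
rewrite /= /upd /= hK k1 k2 k3 /s2 /= /upd /= f1 f2 f3 f4 f5 e1 e2 e3 hT.
by split.
Qed.

Lemma eval_candidate_correct s : base s ->
  let s' := exec eval_candidate s in
  vars s' vKey = key (arrs s aO) (arrs s aC) /\ vars s' vViol = viol (arrs s aC).
Proof.
move=> hb; cbv zeta; rewrite /eval_candidate !exec_seq; set s1 := exec (vPos <~ _) _.
have [h1 h2 h3 h4 [_ _ _ h5]] := hb.
have := @for_ind inp (fun j s' =>
  [/\ vars s' vKey = pack (map (digit (arrs s aO) (arrs s aC)) (coordinates n j)),
      vars s' vViol = \sum_(0 <= j' < j) \sum_(0 <= i < n) (dis (arrs s aC) i (tm j') - lam j') &
      vars s' vPos = off + 2 * j]) vj vTau add_constraint s1.
rewrite (_ : vars s1 vTau = tau) // => H.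
have [| |-> -> _] := H.
- by rewrite big_geq // addn0; split.
- move=> j s' hj [frv fra] [I1 I2 I3].
  have A a : arrs s' a = arrs s a by rewrite fra.
  have hb' : base s'.
    have b1 : base s1 by exact: (@base_exec (vKey <~ 0 ;; vViol <~ 0 ;; vPos <~ $vOff)).
    by apply: (@base_framed (For vj $vTau add_constraint)) b1 => //; split.
  rewrite /add_constraint !exec_seq; set s2 := exec (vPtr <~ 3) _.
  have hb2 : base s2.
    by apply: (@base_exec (vj <~ j ;; vT <~ Input $vPos ;; vLam <~ Input ($vPos :+ 1) ;;
      vPos <~ $vPos :+ 2 ;; vPtr <~ 3) _ _ hb').
  have A2 a : arrs s2 a = arrs s a by rewrite -A.
  have := @for_ind inp (fun i s' =>
    [/\ vars s' vKey = pack (map (digit (arrs s aO) (arrs s aC))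
            (coordinates n j ++ [seq (j, i') | i' <- iota 0 i])),
        vars s' vViol = vars s2 vViol + \sum_(0 <= i' < i) (dis (arrs s aC) i' (tm j) - lam j) &
        vars s' vPtr = 3 + i * l * m]) vi vN add_agent s2.
  rewrite (_ : vars s2 vN = n); last by have [] := hb2.
  move=> H2; have [| |K1 K2 _] := H2.
  + by rewrite big_geq //= cats0 !addn0 -I1.
  + move=> i s3 hi [frv3 fra3] [J1 J2 J3].
    have hb3 : base (set_var s3 vi i).
      apply: (@base_exec (vi <~ i)) => //.
      by apply: (@base_framed (For vi $vN add_agent)) hb2.
    have A3 a : arrs (set_var s3 vi i) a = arrs s a by rewrite /= fra3 // A2.
    have T3 : vars (set_var s3 vi i) vT = tm j.
      by rewrite /= /upd /= frv3 // /s2 /= /upd /= I3.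
    have L3 : vars (set_var s3 vi i) vLam = lam j.
      by rewrite /= /upd /= frv3 // /s2 /= /upd /= I3.
    have [|Q1 Q2 Q3] := @add_agent_correct _ j i hb3 _ T3 L3; first by rewrite /= /upd /= J3.
    split=> //; last first.
      by rewrite Q1 !A3 big_nat_recr //= /upd /= J2 addnA.
    have -> : coordinates n j ++ [seq (j, i') | i' <- iota 0 i.+1] =
              rcons (coordinates n j ++ [seq (j, i') | i' <- iota 0 i]) (j, i).
      by rewrite -[i.+1]addn1 iotaD map_cat catA cats1.
    by rewrite Q2 !A3 map_rcons pack_rcons /= /upd /= J1.
  + split.
    * by rewrite K1 coordinatesS.
    * by rewrite K2 big_nat_recr //= -I2.
    * have [f _] := framed_exec inp (For vi $vN add_agent) s2.
      by rewrite f // /s2 /= /upd /= I3; lia.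
by split.
Qed.

(** * The table of the dynamic program *)

Definition entry s e q := arrs s aTab (e * l + q).
Definition full s e := arrs s aFull e != 0.

Definition table_inv O s :=
  [/\ base s, arrs s aO = O, valid (arrs s aBest), vars s vBest = viol (arrs s aBest) &
   forall e, e < table_size -> full s e ->
     [/\ key O (entry s e) = e, valid (entry s e) & vars s vBest <= viol (entry s e)]].

(** Filled slots keep their contents, which is needed because the table is scanned while it
    grows. *)
Definition extends s s' :=
  vars s' vBest <= vars s vBest /\
  forall e, e < table_size -> full s e ->
    full s' e /\ forall q, q < l -> entry s' e q = entry s e q.

Lemma extends_trans s1 s2 s3 : extends s1 s2 -> extends s2 s3 -> extends s1 s3.
Proof.
move=> [b1 h1] [b2 h2]; split; first exact: leq_trans b1.
move=> e he fe; have [f1 e1] := h1 _ he fe; have [f2 e2] := h2 _ he f1.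
by split=> // q hq; rewrite e2 ?e1.
Qed.

Lemma eq_viol_outcome o o' : (forall k, k < l -> o k = o' k) -> viol o = viol o'.
Proof. by move=> h; apply: eq_viol => j i _ _; apply: eq_dis. Qed.

Lemma eq_valid o o' : (forall k, k < l -> o k = o' k) -> valid o -> valid o'.
Proof. by move=> h v k hk; rewrite -h ?v. Qed.

Lemma framed_table c s s' : framed c s s' ->
  all (fun x => x \notin written_vars c) (vBest :: iota 1 8) ->
  all (fun a => a \notin written_arrs c) [:: aO; aTab; aFull; aBest] ->
  extends s s' /\ forall O, table_inv O s -> table_inv O s'.
Proof.
move=> fr /= /andP[hbest hv] /and5P[n0 n2 n3 n4 _].
have [v a] := fr.
split; first by rewrite /extends v //; split=> // e he; rewrite /full /entry !a.
move=> O [h1 h2 h3 h4 h5]; split; rewrite ?a ?v //; first exact: base_framed fr _ h1.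
by move=> e he; rewrite /full /entry !a // => fe; apply: h5.
Qed.

Lemma copy_correct (a1 a2 : nat) s : a1 != a2 -> vars s vL = l ->
  forall q, q < l -> arrs (exec (copy_block a1 0 a2 0) s) a2 q = arrs s a1 q.
Proof. by move=> ne hl q hq; case: (@copy_block_correct a1 0 a2 0 s) => // + _; apply. Qed.

Lemma insert_candidate_correct O s : table_inv O s -> valid (arrs s aC) ->
  let s' := exec insert_candidate s in
  [/\ table_inv O s', extends s s', full s' (key O (arrs s aC)) &
   forall e, e < table_size -> full s' e ->
     full s e \/ forall q, q < l -> entry s' e q = arrs s aC q].
Proof.
move=> hs vC; cbv zeta; rewrite /insert_candidate exec_seq.
have hb : base s by case: hs.
have hO : arrs s aO = O by case: hs.
have [] := eval_candidate_correct hb.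
have fr := framed_exec inp eval_candidate s; set s1 := exec eval_candidate s in fr *.
have A1 a : arrs s1 a = arrs s a by rewrite fr.2.
have [ext1 /(_ _ hs) hs1] := framed_table fr isT isT.
rewrite hO; set C := arrs s aC; move=> hkey hviol.
have full1 e : full s1 e = full s e by rewrite /full A1.
have kl : key O C < table_size by exact: key_lt.
rewrite exec_if; case: eqP => fk; last first.
  (* The slot is already taken, so only scratch memory has changed. *)
  split=> //; first by rewrite -hkey; apply/eqP.
  by move=> e _; rewrite full1; left.
have {}fk : arrs s1 aFull (vars s1 vKey) = 0 by exact: fk.
rewrite exec_seq; set s2 := exec (Store _ _ _) s1.
rewrite exec_seq; set s3 := exec (mul_into _ _ _) s2.
rewrite exec_seq; set s4 := exec (copy_block _ _ _ _) s3.
set c5 := If _ _ _; set s5 := exec c5 s4.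
have fr3 := framed_exec inp (mul_into vBase vL vKey) s2; rewrite -/s3 in fr3.
have fr4 := framed_exec inp (copy_block aC 0 aTab $vBase) s3; rewrite -/s4 in fr4.
have fr5 := framed_exec inp c5 s4; rewrite -/s5 in fr5.
have hb1 : base s1 by case: hs1.
have hb2 : base s2 by [].
have hb3 : base s3 by apply: base_framed fr3 _ hb2.
have hb4 : base s4 by apply: base_framed fr4 _ hb3.
have hb5 : base s5 by apply: base_framed fr5 _ hb4.
have hbase : vars s3 vBase = l * key O C.
  by rewrite /s3 mul_into_correct // -hkey; case: hb2 => _ _ -> .
have A4 a : a \in [:: aO; aC; aBest] -> arrs s4 a = arrs s a.
  by rewrite !inE => ha; rewrite fr4.2 ?fr3.2 //= ?A1 //; move: ha => /or3P[]/eqP->.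
have full4 e : full s4 e = (e == key O C) || full s e.
  rewrite /full fr4.2 // fr3.2 // /s2 /= /upd hkey.
  by case: (e =P _) => // _; rewrite A1.
have [|||in4 out4] := @copy_block_correct aC 0 aTab ($vBase) s3 => //.
- by case: hb3.
- by move=> s' hv /=; rewrite hv.
rewrite /= -/s4 hbase fr3.2 // in in4 out4.
have ent4 q : q < l -> entry s4 (key O C) q = C q.
  by move=> hq; rewrite /entry mulnC in4 // /s2 /= A1.
have ent4' e q : e != key O C -> q < l -> entry s4 e q = entry s e q.
  move=> ne hq; rewrite /entry out4.
    by rewrite fr3.2 // /s2 /= A1.
  (* Slots are disjoint blocks of length [l], so another slot lies wholly before or after the
     written block. *)
  case: (ltngtP e (key O C)) ne => // he _.
    by apply/orP; left; have := leq_mul (leqnn l) he; rewrite mulnS mulnC; lia.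
  by apply/orP; right; have := leq_mul (leqnn l) he; rewrite mulnS mulnC [l * e]mulnC; lia.
have best4 : vars s4 vBest = vars s vBest.
  by rewrite fr4.1 // fr3.1 // /s2 /= fr.1.
have viol4 : vars s4 vViol = viol C.
  by rewrite fr4.1 // fr3.1 // /s2 /=.
have [_ _ vbest bestE tab] := hs.
have [b1 b2 b3 b4] : [/\ vars s5 vBest <= vars s vBest, vars s5 vBest <= viol C,
    valid (arrs s5 aBest) & vars s5 vBest = viol (arrs s5 aBest)].
  rewrite /s5 /c5 exec_if (_ : eval _ s4 = vars s vBest - viol C); last first.
    by rewrite /= best4 viol4.
  rewrite subn_eq0; case: ifPn => hv.
    by rewrite (_ : exec Skip s4 = s4) // best4 A4.
  rewrite exec_seq; set s6 := exec (vBest <~ _) s4.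
  have fr7 := framed_exec inp (copy_block aC 0 aBest 0) s6.
  have best7 : forall q, q < l -> C q = arrs (exec (copy_block aC 0 aBest 0) s6) aBest q.
    by move=> q hq; rewrite copy_correct //; [rewrite /= A4|case: hb4].
  have vb6 : vars s6 vBest = viol C by rewrite /s6 /= /upd /= viol4.
  rewrite fr7.1 // vb6 -(eq_viol_outcome best7).
  by split=> //; [rewrite ltnW // ltnNge|apply: eq_valid best7 vC].
have full5 e : full s5 e = full s4 e by rewrite /full fr5.2.
have ent5 e q : entry s5 e q = entry s4 e q by rewrite /entry fr5.2.
split.
- split=> //; first by rewrite fr5.2 // A4.
  move=> e he; rewrite full5 full4; case: eqP => [-> _|/eqP ne /= fe].
    have same q : q < l -> C q = entry s5 (key O C) q by move=> hq; rewrite ent5 ent4.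
    rewrite -(eq_key n tau input_bit tm g O same) -(eq_viol_outcome same).
    by split=> //; apply: eq_valid same vC.
  have same q : q < l -> entry s e q = entry s5 e q by move=> hq; rewrite ent5 ent4'.
  have [t1 t2 t3] := tab _ he fe.
  rewrite -(eq_key n tau input_bit tm g O same) -(eq_viol_outcome same).
  by split=> //; [apply: eq_valid same t2|apply: leq_trans t3].
- split=> // e he fe; split; first by rewrite full5 full4 fe orbT.
  move=> q hq; rewrite ent5; case: (e =P key O C) => [ek|/eqP ne]; last exact: ent4'.
  by move: fe; rewrite /full -A1 ek -hkey fk.
- by rewrite full5 full4 eqxx.
- move=> e he; rewrite full5 full4; case: eqP => [-> _|_ /= ->]; last by left.
  by right=> q hq; rewrite ent5 ent4.
Qed.

(** Stored outcomes are partial choices completed by [O]. *)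
Definition agree_from k (O : nat -> nat) s := forall e, e < table_size -> full s e ->
  forall q, k <= q < l -> entry s e q = O q.

Lemma extend_entry_correct O s e k p : table_inv O s -> agree_from k.+1 O s ->
  vars s ve = e -> vars s vkk = k -> vars s vp = p ->
  e < table_size -> full s e -> k < l -> p < m ->
  let s' := exec extend_entry s in
  [/\ table_inv O s', extends s s', agree_from k.+1 O s' &
      full s' (key O (upd (entry s e) k p))].
Proof.
move=> hs agr he hk hp eS fe kl pm; cbv zeta; rewrite /extend_entry.
set c1 := mul_into _ _ _; set c2 := copy_block _ _ _ _; set c3 := Store _ _ _.
rewrite (_ : exec _ s = exec insert_candidate (exec (c1 ;; c2 ;; c3) s)) //.
have fr := framed_exec inp (c1 ;; c2 ;; c3) s; set s3 := exec _ s in fr *.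
have [ext3 /(_ _ hs) hs3] := framed_table fr isT isT.
pose s1 := exec c1 s; pose s2 := exec c2 s1.
have fr1 : framed c1 s s1 := framed_exec inp c1 s.
have fr2 : framed c2 s1 s2 := framed_exec inp c2 s1.
have [hb _ _ _ tab] := hs; have [_ _ hl _ _] := hb.
have hbase : vars s1 vBase = l * e by rewrite /s1 mul_into_correct // hl he.
have [||in2 _] := @copy_block_correct aTab ($vBase) aC 0 s1 isT; first by rewrite fr1.1.
  by move=> s' hv /=; rewrite hv.
rewrite /= -/c2 -/s2 hbase in in2.
have C3 : arrs s3 aC = upd (arrs s2 aC) k p.
  by rewrite /s3 (_ : exec _ s = exec c3 s2) // /c3 /= fr2.1 // fr1.1 // hk fr2.1 // fr1.1 // hp.
have same q : q < l -> arrs s3 aC q = upd (entry s e) k p q.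
  move=> hq; rewrite C3 /upd; case: eqP => // _.
  by rewrite -[q]add0n in2 // fr1.2 // /entry mulnC.
have [_ val _] := tab _ eS fe.
have vC : valid (arrs s3 aC).
  by move=> q hq; rewrite same // /upd; case: eqP => // _; apply: val.
have [h1 h2 h3 h4] := insert_candidate_correct hs3 vC.
split=> //; first exact: extends_trans ext3 h2.
- move=> e' he' fe' q /andP[kq ql].
  case: (h4 e' he' fe') => [f3|->//].
    have [_ ext] := h2; have [_ ->//] := ext _ he' f3.
    rewrite (_ : entry s3 e' q = entry s e' q); last by rewrite /entry fr.2.
    by apply: agr; rewrite ?kq // -(_ : full s3 e' = full s e') // /full fr.2.
  by rewrite same // /upd; case: eqP => [?|_]; [lia|apply: agr; rewrite ?kq].
- by rewrite -(eq_key n tau input_bit tm g O same).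
Qed.

Lemma fill_entry_correct O s e k : table_inv O s -> agree_from k.+1 O s ->
  vars s ve = e -> vars s vkk = k -> e < table_size -> k < l ->
  let s' := exec fill_entry s in
  [/\ table_inv O s', extends s s', agree_from k.+1 O s' &
      full s e -> forall p, p < m -> full s' (key O (upd (entry s e) k p))].
Proof.
move=> hs agr he hk eS kl; cbv zeta; rewrite /fill_entry exec_if.
have cond : eval (Arr aFull $ve) s = arrs s aFull e by rewrite /= he.
rewrite cond -[_ == 0]negbK -/(full s e); case: ifPn => fe.
  by split=> // fe'; rewrite fe' in fe.
rewrite negbK in fe.
have [[_ hm _ _ _] _ _ _ _] := hs.
have := @for_ind inp (fun p s' => [/\ table_inv O s', extends s s', agree_from k.+1 O s' &
  forall p', p' < p -> full s' (key O (upd (entry s e) k p'))]) vp vM extend_entry s.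
rewrite hm => H; have [||h1 h2 h3 h4] := H;
  [by split|move=> p s' hp [frv fra] [i1 i2 i3 i4]|by split].
have fr : framed (vp <~ p) s' (set_var s' vp p) := framed_exec inp (vp <~ p) s'.
have [ext4 /(_ _ i1) hs4] := framed_table fr isT isT.
have fe4 : full (set_var s' vp p) e by case: i2 => _ /(_ _ eS fe)[].
have ent4 q : q < l -> entry (set_var s' vp p) e q = entry s e q.
  by case: i2 => _ /(_ _ eS fe)[_ h] hq; apply: h.
have [||j1 j2 j3 j4] :=
  @extend_entry_correct O (set_var s' vp p) e k p hs4 i3 _ _ erefl eS fe4 kl hp.
- by rewrite /= /upd /= frv.
- by rewrite /= /upd /= frv.
split=> //; first exact: extends_trans i2 j2.
move=> p'; rewrite ltnS leq_eqVlt => /predU1P[->|/i4 f]; last first.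
  by case: j2 => _ /(_ _ (key_lt _ _ _ _ _ _ _ _) f)[].
rewrite (@eq_key n l tau input_bit tm g O _ (upd (entry (set_var s' vp p) e) k p)) //.
by move=> q hq; rewrite /upd; case: eqP => // _; rewrite ent4.
Qed.

(** The last clause concerns slots filled before the step; by [extends] they still hold the same
    outcome when the scan reaches them. *)
Lemma fill_step_correct O s k : table_inv O s -> agree_from k.+1 O s ->
  vars s vkk = k -> k < l ->
  let s' := exec fill_step s in
  [/\ table_inv O s', extends s s', agree_from k.+1 O s' &
      forall e, e < table_size -> full s e ->
        forall p, p < m -> full s' (key O (upd (entry s e) k p))].
Proof.
move=> hs agr hk kl; cbv zeta; rewrite /fill_step.
have [[_ _ _ _ [_ _ hS _]] _ _ _ _] := hs.
have := @for_ind inp (fun e s' => [/\ table_inv O s', extends s s', agree_from k.+1 O s' &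
  forall e', e' < e -> full s e' ->
    forall p, p < m -> full s' (key O (upd (entry s e') k p))]) ve vS fill_entry s.
rewrite hS => H; have [||h1 h2 h3 h4] := H;
  [by split|move=> e s' eS [frv fra] [i1 i2 i3 i4]|by split].
have fr : framed (ve <~ e) s' (set_var s' ve e) := framed_exec inp (ve <~ e) s'.
have [ext4 /(_ _ i1) hs4] := framed_table fr isT isT.
have [||j1 j2 j3 j4] := @fill_entry_correct O (set_var s' ve e) e k hs4 i3 _ _ eS kl => //.
  by rewrite /= /upd /= frv.
split=> //; first exact: extends_trans i2 j2.
move=> e'; rewrite ltnS leq_eqVlt => /predU1P[->|he'] fe p hp; last first.
  by case: j2 => _ /(_ _ (key_lt _ _ _ _ _ _ _ _) (i4 _ he' fe _ hp))[].
have [_ /(_ _ eS fe)[fe4 ent4]] := i2.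
rewrite (@eq_key n l tau input_bit tm g O _ (upd (entry (set_var s' ve e) e) k p)).
  exact: j4.
by move=> q hq; rewrite /upd; case: eqP => // _; rewrite -ent4.
Qed.

Hypothesis bit_le1 : forall i k p, i < n -> k < l -> p < m -> input_bit i k p <= 1.

(** Only the profile of the hybrid must be present, not the hybrid itself. *)
Definition covered k O s o' := exists e, [/\ e < table_size, full s e &
  forall j i, j < tau -> i < n -> dis (entry s e) i (tm j) = dis (mix k o' O) i (tm j)].

Lemma fill_step_covers O s k o' : table_inv O s -> agree_from k O s ->
  vars s vkk = k -> k < l -> valid O -> valid o' -> hamming l o' O < g ->
  covered k O s o' -> covered k.+1 O (exec fill_step s) o'.
Proof.
move=> hs agr hk kl vO vo' near [e [eS fe he]].
have agr1 : agree_from k.+1 O s.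
  by move=> e' he' fe' q /andP[kq ql]; apply: agr => //; rewrite ql ltnW.
have [h1 h2 h3 h4] := fill_step_correct hs agr1 hk kl.
set s' := exec fill_step s in h1 h2 h3 h4 *.
set C := upd (entry s e) k (o' k).
have disC j i : j < tau -> i < n -> dis C i (tm j) = dis (mix k.+1 o' O) i (tm j).
  move=> hj hi; rewrite dis_mixS //.
  (* The stored outcome and the hybrid both choose [O k] at timestep [k], so changing that choice to
     [o' k] shifts their equal counts by the same amount. *)
  have := dis_upd input_bit (entry s e) (o' k) i (tm j) kl; rewrite -/C he //.
  have := dis_upd input_bit (mix k o' O) (o' k) i (tm j) kl.
  rewrite (agr e eS fe k) ?leqnn // {2}/mix ltnn => <-; exact: addIn.
have vmix : valid (mix k.+1 o' O).
  by move=> q hq; rewrite /mix; case: ifP => _; [apply: vo'|apply: vO].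
have close : hamming l (mix k.+1 o' O) O < g by apply: leq_ltn_trans (hamming_mix _ _ _ _) near.
exists (key O C); split; first exact: key_lt.
  exact: h4 eS fe _ (vo' _ kl).
move=> j i hj hi; rewrite -disC //.
have [_ _ _ _ tab] := h1.
have [ekey _ _] := tab _ (key_lt _ _ _ _ _ _ _ _) (h4 _ eS fe _ (vo' _ kl)).
(* The slot may hold a different outcome with this key. The next hybrid is strictly inside the box,
   so the key still determines the counts. *)
apply: key_inj ekey _ _ _ hj hi => j' i' hj' hi'; rewrite disC //.
have := dis_hamming bit_le1 (tm j') vmix vO hi'.
have := dis_hamming bit_le1 (tm j') vO vmix hi'.
have -> : hamming l O (mix k.+1 o' O) = hamming l (mix k.+1 o' O) O.
  by apply: eq_bigr => q _; rewrite eq_sym.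
lia.
Qed.

(** After all [l] steps the hybrid is [o'] itself, so every outcome closer than g shares its
    violation with a table entry, and no entry beats the recorded best. *)
Lemma round_correct s : base s -> valid (arrs s aBest) ->
  vars s vBest = viol (arrs s aBest) ->
  let s' := exec round s in
  [/\ base s', valid (arrs s' aBest), vars s' vBest = viol (arrs s' aBest) &
   forall o', valid o' -> hamming l o' (arrs s aBest) < g -> vars s' vBest <= viol o'].
Proof.
move=> hb vb best; cbv zeta; rewrite /round.
rewrite exec_seq; set s1 := exec (copy_block _ _ _ _) s.
rewrite exec_seq; set s2 := exec (copy_block _ _ _ _) s1.
rewrite exec_seq; set s3 := exec (For _ _ _) s2.
rewrite exec_seq; set s4 := exec insert_candidate s3.
have fr1 := framed_exec inp (copy_block aBest 0 aO 0) s; rewrite -/s1 in fr1.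
have fr2 := framed_exec inp (copy_block aBest 0 aC 0) s1; rewrite -/s2 in fr2.
have fr3 := framed_exec inp (For ve $vS (Store aFull $ve 0)) s2; rewrite -/s3 in fr3.
have hb1 := base_framed fr1 isT hb; have hb2 := base_framed fr2 isT hb1.
have hb3 := base_framed fr3 isT hb2.
have hl : vars s vL = l by case: hb.
pose O := arrs s1 aO.
have OE q : q < l -> O q = arrs s aBest q by move=> hq; rewrite /O copy_correct.
have CE q : q < l -> arrs s3 aC q = O q.
  move=> hq; rewrite fr3.2 // OE // copy_correct //; last by case: hb1.
  by rewrite fr1.2.
have vO : valid O by apply: eq_valid vb => q hq; rewrite OE.
have vC : valid (arrs s3 aC) by apply: eq_valid vO => q hq; rewrite CE.
have empty e : e < table_size -> ~~ full s3 e.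
  have := @for_ind inp (fun e s' => forall e', e' < e -> ~~ full s' e') ve vS
    (Store aFull $ve 0) s2.
  rewrite -/s3 (_ : vars s2 vS = table_size); last by case: hb2 => _ _ _ _ [].
  apply=> // k s' _ _ IH e'; rewrite /full /= /upd ltnS leq_eqVlt /= => /predU1P[->|he'].
    by rewrite eqxx.
  by case: (e' =P k) => // _; apply: IH.
have best3 : arrs s3 aBest = arrs s aBest by rewrite fr3.2 // fr2.2 // fr1.2.
have hs3 : table_inv O s3.
  split=> //; first by rewrite fr3.2 // fr2.2.
  - by rewrite best3.
  - by rewrite best3 fr3.1 // fr2.1 // fr1.1.
  - by move=> e /empty/negPf ->.
have [hs4 _ full4 new4] := insert_candidate_correct hs3 vC; rewrite -/s4 in hs4 full4 new4.
have agr4 : agree_from 0 O s4.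
  move=> e he fe q hq; case: (new4 e he fe) => [fe3|->//]; last exact: CE.
  by have := empty e he; rewrite fe3.
(* The hybrid with [k = 0] is [O], the outcome just inserted. *)
have cov4 o' : covered 0 O s4 o'.
  exists (key O (arrs s3 aC)); split=> //; first exact: key_lt.
  move=> j i _ _; apply: eq_dis => q hq; rewrite agr4 ?key_lt //.
have := @for_ind inp (fun k s' => [/\ table_inv O s', agree_from k O s' &
   forall o', valid o' -> hamming l o' O < g -> covered k O s' o']) vkk vL fill_step s4.
rewrite (_ : vars s4 vL = l); last by case: hs4 => -[].
move=> H; have [||i1 i2 i3] := H; first by split.
  move=> k s' hk [frv fra] [j1 j2 j3].
  have fr : framed (vkk <~ k) s' (set_var s' vkk k) := framed_exec inp (vkk <~ k) s'.
  have [_ /(_ _ j1) hs5] := framed_table fr isT isT.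
  have agr5 : agree_from k.+1 O (set_var s' vkk k).
    by move=> e' he' fe' q /andP[kq ql]; apply: j2 => //; rewrite ql ltnW.
  have [k1 _ k3 _] := fill_step_correct hs5 agr5 erefl hk.
  split=> // o' vo' ho'; apply: fill_step_covers => //; exact: j3.
case: i1 => k1 _ k3 k4 k5; split=> // o' vo' ho'.
have ho : hamming l o' O < g.
  by rewrite (_ : hamming l o' O = hamming l o' (arrs s aBest)) //;
    apply: eq_big_nat => q /andP[_ hq]; rewrite OE.
have [e [eS fe he]] := i3 o' vo' ho.
have [_ _ le] := k5 e eS fe; apply: leq_trans le _.
suff -> : viol (entry (exec (For vkk $vL fill_step) s4) e) = viol o' by [].
apply: eq_viol => j i hj hi; rewrite he //.
by apply: eq_dis => q hq; rewrite /mix hq.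
Qed.

(** * The local search *)

Definition solvable := exists2 o, valid o & viol o = 0.

Lemma search_init_correct s : base s -> 0 < m ->
  let s' := exec search_init s in
  [/\ base s', valid (arrs s' aBest), vars s' vBest = viol (arrs s' aBest) &
      vars s' vRounds = vars s' vBest].
Proof.
move=> hb m0; cbv zeta; rewrite /search_init.
set c0 := For _ _ _.
rewrite exec_seq; set s0 := exec c0 s.
rewrite exec_seq; set s1 := exec (copy_block _ _ _ _) s0.
rewrite exec_seq; set s2 := exec (copy_block _ _ _ _) s1.
rewrite exec_seq; set s3 := exec eval_candidate s2.
have fr0 : framed c0 s s0 := framed_exec inp c0 s.
have fr1 := framed_exec inp (copy_block aBest 0 aO 0) s0; rewrite -/s1 in fr1.
have fr2 := framed_exec inp (copy_block aBest 0 aC 0) s1; rewrite -/s2 in fr2.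
have fr3 := framed_exec inp eval_candidate s2; rewrite -/s3 in fr3.
have hb0 := base_framed fr0 isT hb.
have hb1 := base_framed fr1 isT hb0; have hb2 := base_framed fr2 isT hb1.
have hb3 := base_framed fr3 isT hb2.
have best q : q < l -> arrs s0 aBest q = 0.
  have := @for_ind inp (fun k s' => forall q, q < k -> arrs s' aBest q = 0) vq vL
     (Store aBest $vq 0) s.
  rewrite (_ : vars s vL = l); last by case: hb.
  apply=> // k s' _ _ IH q'; rewrite /= /upd /= ltnS leq_eqVlt => /predU1P[->|hq].
    by rewrite eqxx.
  by case: eqP => // _; apply: IH.
have [_ hv] := eval_candidate_correct hb2; rewrite -/s3 in hv.
have A3 : arrs s3 aBest = arrs s0 aBest by rewrite fr3.2 // fr2.2 // fr1.2.
have cand q : q < l -> arrs s2 aC q = arrs s0 aBest q.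
  by move=> hq; rewrite copy_correct //; [rewrite fr1.2|case: hb1].
split; rewrite /= /upd //=.
- by rewrite A3 => q /best ->.
- by rewrite A3 hv; apply: eq_viol_outcome.
Qed.

(** On solvable instances the best violation after r rounds is at most the initial one minus r. The
    number of rounds is the initial violation, so a positive final value refutes solvability. *)
Lemma search_correct s : base s -> 0 < m -> group_bound (tau * n) < g ->
  vars (exec search s) vAns = 1 /\ solvable \/
  vars (exec search s) vAns = 0 /\ ~ solvable.
Proof.
move=> hb m0 hg; rewrite /search exec_seq; set s1 := exec search_init s.
have [hb1 v1 e1 r1] := search_init_correct hb m0; rewrite -/s1 in hb1 v1 e1 r1.
rewrite exec_seq; set s2 := exec search_rounds s1.
have := @for_ind inp (fun r s' => [/\ base s', valid (arrs s' aBest),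
   vars s' vBest = viol (arrs s' aBest) &
   solvable -> vars s' vBest <= vars s1 vRounds - r]) vU vRounds round s1.
rewrite -/search_rounds -/s2 => H; have [||h1 h2 h3 h4] := H.
- by split=> //; rewrite r1 subn0.
- move=> r s' hr _ [i1 i2 i3 i4].
  have i1' : base (set_var s' vU r) by apply: (@base_exec (vU <~ r)).
  have [j1 j2 j3 j4] := round_correct i1' i2 i3.
  split=> // sol; have {i4} := i4 sol; rewrite i3.
  (* A violation of zero persists, because the centre itself is at distance 0 < g. *)
  case: (posnP (viol (arrs s' aBest))) => [z _|pos le].
    have near : hamming l (arrs s' aBest) (arrs s' aBest) < g.
      rewrite (_ : hamming _ _ _ = 0); first exact: leq_ltn_trans hg.
      by apply: big1 => q _; rewrite eqxx.
    by have := j4 _ i2 near; rewrite z leqn0 => /eqP->.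
  case: sol => os vos zos.
  have [o' [vo' ho' lo']] := improvement bit_le1 i2 vos zos pos.
  have := j4 _ vo' (leq_ltn_trans ho' hg); lia.
rewrite /= /upd /=; case: (posnP (vars s2 vBest)) => [z|pos].
  by left; rewrite z; split=> //; exists (arrs s2 aBest); rewrite // -h3.
right; split; first lia.
by move=> /h4; rewrite subnn; lia.
Qed.

Lemma search_loops_le W s : base s -> 0 < m ->
  [/\ n <= W, m <= W, l <= W & tau <= W] -> (g + g).+1 <= W -> table_size <= W ->
  tau * n * l <= W -> loops_le inp W search s.
Proof.
move=> hb m0 [wn wm wl wt] wg ws wr.
have const s' : base s' -> forall y, y \in [:: vN; vM; vL; vTau; vB; vS] -> vars s' y <= W.
  by case=> h1 h2 h3 h4 [_ h5 h6 _] y;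
    rewrite !inE => /or4P[|||/or3P[]] /eqP->; rewrite ?h1 ?h2 ?h3 ?h4 ?h5 ?h6.
have [hb1 v1 e1 r1] := search_init_correct hb m0.
split.
  by apply: (@fixed_bounds_loops_le _ [:: vN; vM; vL; vTau; vB; vS]) => //; apply: const.
split=> //.
apply: (@fixed_bounds_loops_le _ [:: vRounds; vN; vM; vL; vTau; vB; vS]) => // y.
rewrite inE => /predU1P[->|]; last exact: const.
by rewrite r1 e1; apply: leq_trans (viol_le _ _ _ bit_le1 v1) wr.
Qed.

End Correctness.

(** * Computing the parameters of the search *)

Section Setup.
Variables (inp : seq nat).
Local Notation exec := (exec inp).

Lemma pow2_into_correct (x y : nat) s : x != y -> x != vz ->
  vars (exec (pow2_into x y) s) x = 2 ^ vars s y.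
Proof.
move=> xy xz; rewrite /pow2_into exec_seq; set s1 := exec _ s.
rewrite -(_ : vars s1 y = vars s y); last by rewrite /s1 /= /upd eq_sym (negPf xy).
apply: (for_ind (I := fun k s' => vars s' x = 2 ^ k)).
  by rewrite /s1 /= /upd eqxx.
by move=> k s' _ _ IH; rewrite /= {1}/upd eqxx /upd (negPf xz) IH addnn expnS mul2n.
Qed.

(** It squares when d grows by one, which outruns the recurrence of [group_bound], and it is
    computed by doublings alone. *)
Definition clamp_radius d := 2 ^ (2 ^ d).*2.

Lemma read_layout_correct n m l tau s :
  vars s vN = n -> vars s vM = m -> vars s vL = l -> nth 0 inp (3 + n * l * m) = tau ->
  vars (exec read_layout s) vTau = tau /\
  vars (exec read_layout s) vOff = 3 + n * l * m + 1.
Proof.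
move=> hn hm hl ht; rewrite /read_layout exec_seq; set s1 := exec _ s.
have fr1 : framed (mul_into vAcc vL vM) s s1 := framed_exec inp _ _.
have acc : vars s1 vAcc = l * m by rewrite /s1 mul_into_correct // hl hm.
rewrite exec_seq; set s2 := exec _ s1.
have hoff : vars s2 vOff = n * l * m.
  by rewrite /s2 mul_into_correct // acc fr1.1 // hn mulnA.
by rewrite /= /upd /= hoff addnC ht.
Qed.

Lemma table_size_correct (s : store) :
  vars s vS = 1 ->
  vars (exec (For vk $vD table_size_step) s) vS = vars s vB ^ vars s vD.
Proof.
move=> s1.
apply: (for_ind (I := fun k s' => vars s' vS = vars s vB ^ k)) => // k s' _ fr IH.
rewrite /table_size_step exec_seq; set s2 := exec (mul_into _ _ _) _.
have acc : vars s2 vAcc = vars s vB ^ k.+1.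
  by rewrite /s2 mul_into_correct // expnS -IH -(fr.1 vB).
by rewrite /= /upd.
Qed.

Lemma setup_correct n m l tau s :
  vars s vN = n -> vars s vM = m -> vars s vL = l -> nth 0 inp (3 + n * l * m) = tau ->
  base n m l tau (clamp_radius (tau * n)) (3 + n * l * m + 1) (exec setup s).
Proof.
move=> hn hm hl ht; rewrite /setup.
rewrite exec_seq; set s1 := exec _ s.
have fr1 : framed read_layout s s1 := framed_exec inp _ _.
have [t1 o1] := read_layout_correct hn hm hl ht; rewrite -/s1 in t1 o1; clearbody s1.
rewrite exec_seq; set s2 := exec _ s1.
have fr2 : framed (mul_into vD vTau vN) s1 s2 := framed_exec inp _ _.
have d2 : vars s2 vD = tau * n by rewrite /s2 mul_into_correct // t1 fr1.1 // hn.
clearbody s2; rewrite exec_seq; set s3 := exec _ s2.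
have fr3 : framed (pow2_into vU vD) s2 s3 := framed_exec inp _ _.
have u3 : vars s3 vU = 2 ^ (tau * n) by rewrite /s3 pow2_into_correct // d2.
clearbody s3; rewrite exec_seq; set s4 := exec _ s3.
have fr4 : framed (vU <~ $vU :+ $vU) s3 s4 := framed_exec inp _ _.
have u4 : vars s4 vU = (2 ^ (tau * n)).*2 by rewrite /s4 /= /upd /= u3 addnn.
clearbody s4; rewrite exec_seq; set s5 := exec _ s4.
have fr5 : framed (pow2_into vG vU) s4 s5 := framed_exec inp _ _.
have g5 : vars s5 vG = clamp_radius (tau * n) by rewrite /s5 pow2_into_correct // u4.
clearbody s5; rewrite exec_seq exec_seq; set s6 := exec (vS <~ 1) _.
have fr6 : framed (vB <~ $vG :+ $vG :+ 1 ;; vS <~ 1) s5 s6 := framed_exec inp _ _.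
have b6 : vars s6 vB = (clamp_radius (tau * n) + clamp_radius (tau * n)).+1.
  by rewrite /s6 /= /upd /= g5 addn1.
have one6 : vars s6 vS = 1 by [].
clearbody s6; have fr7 := framed_exec inp (For vk $vD table_size_step) s6.
have d6 : vars s6 vD = tau * n by rewrite fr6.1 // fr5.1 // fr4.1 // fr3.1.
split; [| | | |split].
- by rewrite fr7.1 // fr6.1 // fr5.1 // fr4.1 // fr3.1 // fr2.1 // fr1.1.
- by rewrite fr7.1 // fr6.1 // fr5.1 // fr4.1 // fr3.1 // fr2.1 // fr1.1.
- by rewrite fr7.1 // fr6.1 // fr5.1 // fr4.1 // fr3.1 // fr2.1 // fr1.1.
- by rewrite fr7.1 // fr6.1 // fr5.1 // fr4.1 // fr3.1 // fr2.1.
- by rewrite fr7.1 // fr6.1.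
- by rewrite fr7.1.
- by rewrite table_size_correct // b6 d6.
- by rewrite fr7.1 // fr6.1 // fr5.1 // fr4.1 // fr3.1 // fr2.1.
Qed.

Lemma setup_loops_le n m l tau s W :
  vars s vN = n -> vars s vM = m -> vars s vL = l -> nth 0 inp (3 + n * l * m) = tau ->
  n <= W -> l <= W -> tau <= W -> tau * n <= W -> (2 ^ (tau * n)).*2 <= W ->
  (clamp_radius (tau * n) + clamp_radius (tau * n)).+1 <= W ->
  loops_le inp W setup s.
Proof.
move=> hn hm hl ht wn wl wt wd wu wg; rewrite /setup.
set s1 := exec read_layout s.
have fr1 : framed read_layout s s1 := framed_exec inp _ _.
have [t1 o1] := read_layout_correct hn hm hl ht; rewrite -/s1 in t1 o1.
split.
  apply: (@fixed_bounds_loops_le _ [:: vN; vL]) => // y.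
  by rewrite !inE => /orP[]/eqP->; rewrite ?hn ?hl.
rewrite -/s1; clearbody s1; set s2 := exec (mul_into vD vTau vN) s1.
have d2 : vars s2 vD = tau * n by rewrite /s2 mul_into_correct // t1 fr1.1 // hn.
split.
  apply: (@fixed_bounds_loops_le _ [:: vTau]) => // y.
  by rewrite !inE => /eqP->; rewrite t1.
rewrite -/s2; clearbody s2; set s3 := exec (pow2_into vU vD) s2.
have fr3 : framed (pow2_into vU vD) s2 s3 := framed_exec inp _ _.
have u3 : vars s3 vU = 2 ^ (tau * n) by rewrite /s3 pow2_into_correct // d2.
split.
  apply: (@fixed_bounds_loops_le _ [:: vD]) => // y.
  by rewrite !inE => /eqP->; rewrite d2.
rewrite -/s3; clearbody s3; split; first by []; set s4 := exec (vU <~ _) s3.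
have fr4 : framed (vU <~ $vU :+ $vU) s3 s4 := framed_exec inp _ _.
have u4 : vars s4 vU = (2 ^ (tau * n)).*2 by rewrite /s4 /= /upd /= u3 addnn.
clearbody s4; set s5 := exec (pow2_into vG vU) s4.
have fr5 : framed (pow2_into vG vU) s4 s5 := framed_exec inp _ _.
have g5 : vars s5 vG = clamp_radius (tau * n) by rewrite /s5 pow2_into_correct // u4.
split.
  apply: (@fixed_bounds_loops_le _ [:: vU]) => // y.
  by rewrite !inE => /eqP->; rewrite u4.
rewrite -/s5; clearbody s5; split; first by []; split; first by [].
set s6 := exec (vS <~ 1) (exec (vB <~ _) s5).
have b6 : vars s6 vB = (clamp_radius (tau * n) + clamp_radius (tau * n)).+1.
  by rewrite /s6 /= /upd /= g5 addn1.
have d6 : vars s6 vD = tau * n.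
  by rewrite /s6 /= /upd /= fr5.1 // fr4.1 // fr3.1 // d2.
apply: (@fixed_bounds_loops_le _ [:: vD; vB] _ _ s6) => // y.
by rewrite !inE => /orP[]/eqP->; rewrite ?b6 ?d6.
Qed.
End Setup.

Lemma group_bound_lt d : group_bound d < clamp_radius d.
Proof.
(* With the factor 4 the induction closes, since 4 (2G+1) G <= (4G)^2 for G >= 1. *)
suff h : 4 * group_bound d <= clamp_radius d.
  by apply: leq_trans h; rewrite -(ltn_pmul2l (isT : 0 < 1)); elim: (d) => //= e; nia.
elim: d => // d IH.
have -> : clamp_radius d.+1 = clamp_radius d * clamp_radius d.
  by rewrite /clamp_radius -expnD addnn expnS mul2n.
have pos : 0 < group_bound d by elim: (d) => //= e; nia.
rewrite /=; nia.
Qed.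

(** * The encoding and the final bounds *)

Lemma size_flatten_blocks (T : eqType) (ss : seq (seq T)) w :
  (forall s, s \in ss -> size s = w) -> size (flatten ss) = size ss * w.
Proof.
elim: ss => //= s ss IH h; rewrite size_cat h ?mem_head // IH // => s' hs'.
by rewrite h // inE hs' orbT.
Qed.

Lemma nth_flatten_blocks (T : eqType) (x0 : T) (ss : seq (seq T)) w i r :
  (forall s, s \in ss -> size s = w) -> i < size ss -> r < w ->
  nth x0 (flatten ss) (i * w + r) = nth x0 (nth [::] ss i) r.
Proof.
elim: ss i => //= s ss IH [|i] h hi hr; rewrite nth_cat h ?mem_head //.
  by rewrite hr.
rewrite mulSn -addnA ltnNge leq_addr /= addKn IH // => s' hs'.
by rewrite h // inE hs' orbT.
Qed.

Section Encoding.
Variables (n m l : nat) (D : 'I_n -> 'I_l -> {set 'I_m}) (A : seq (nat * nat)).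

Let project_bits i k := [seq nat_of_bool (p \in D i k) | p <- enum 'I_m].
Let agent_bits i := flatten [seq project_bits i k | k <- enum 'I_l].
Let all_bits := flatten [seq agent_bits i | i <- enum 'I_n].

Let size_project_bits i k : size (project_bits i k) = m.
Proof. by rewrite size_map size_enum_ord. Qed.

Let size_agent_bits i : size (agent_bits i) = l * m.
Proof.
rewrite (@size_flatten_blocks _ _ m) 1?size_map ?size_enum_ord //.
by move=> _ /mapP[k _ ->].
Qed.

Let size_all_bits : size all_bits = n * l * m.
Proof.
rewrite (@size_flatten_blocks _ _ (l * m)) 1?size_map ?size_enum_ord ?mulnA //.
by move=> _ /mapP[i _ ->].
Qed.

Let encodeE : encode D A =
  [:: n; m; l] ++ all_bits ++ size A :: flatten [seq [:: c.1; c.2] | c <- A].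
Proof. by []. Qed.

Let nth_encode x : nth 0 (encode D A) (3 + x) =
  nth 0 (all_bits ++ size A :: flatten [seq [:: c.1; c.2] | c <- A]) x.
Proof. by []. Qed.

Lemma size_encode : size (encode D A) = 3 + n * l * m + 1 + 2 * size A.
Proof.
rewrite encodeE !size_cat size_all_bits /= (@size_flatten_blocks _ _ 2).
  by rewrite size_map; lia.
by move=> _ /mapP[c _ ->].
Qed.

Lemma encode_bit (i : 'I_n) (k : 'I_l) (p : 'I_m) :
  input_bit (encode D A) m l i k p = (p \in D i k).
Proof.
rewrite /input_bit -addnA nth_encode nth_cat size_all_bits.
have hi := ltn_ord i; have hk := ltn_ord k; have hp := ltn_ord p.
have h1 : k * m + p < l * m by have := leq_mul hk (leqnn m); rewrite mulSn; lia.
have h2 : i * (l * m) + (k * m + p) < n * l * m.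
  by have := leq_mul hi (leqnn (l * m)); rewrite mulSn -mulnA; lia.
rewrite (_ : (i * l + k) * m + p = i * (l * m) + (k * m + p)); last first.
  by rewrite mulnDl mulnA addnA.
rewrite h2 (@nth_flatten_blocks _ _ _ (l * m)) 1?size_map ?size_enum_ord //; last first.
  by move=> _ /mapP[j _ ->].
rewrite (nth_map i) ?size_enum_ord // nth_ord_enum.
rewrite (@nth_flatten_blocks _ _ _ m) 1?size_map ?size_enum_ord //; last first.
  by move=> _ /mapP[j _ ->].
by rewrite (nth_map k) ?size_enum_ord // nth_ord_enum (nth_map p) ?size_enum_ord // nth_ord_enum.
Qed.

Lemma encode_tau : nth 0 (encode D A) (3 + n * l * m) = size A.
Proof. by rewrite nth_encode nth_cat size_all_bits ltnn subnn. Qed.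

Let encode_constraint j r : j < size A -> r < 2 ->
  nth 0 (encode D A) (3 + n * l * m + 1 + 2 * j + r) =
  nth 0 [:: (nth (0, 0) A j).1; (nth (0, 0) A j).2] r.
Proof.
move=> hj hr; rewrite [2 * j]mulnC -!addnA nth_encode nth_cat size_all_bits.
rewrite ltnNge leq_addr /= addKn add1n [LHS]/=.
rewrite (@nth_flatten_blocks _ _ _ 2) ?size_map //; last by move=> _ /mapP[c _ ->].
by rewrite (nth_map (0, 0)).
Qed.

Lemma encode_time j : j < size A ->
  input_time (encode D A) (3 + n * l * m + 1) j = (nth (0, 0) A j).1.
Proof. by move=> hj; rewrite /input_time -[_ + 2 * j]addn0 encode_constraint. Qed.

Lemma encode_bound j : j < size A ->
  input_bound (encode D A) (3 + n * l * m + 1) j = (nth (0, 0) A j).2.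
Proof. by move=> hj; rewrite /input_bound encode_constraint. Qed.

Lemma encode_bit_le1 i k p : i < n -> k < l -> p < m -> input_bit (encode D A) m l i k p <= 1.
Proof.
by move=> hi hk hp; rewrite (encode_bit (Ordinal hi) (Ordinal hk) (Ordinal hp)) leq_b1.
Qed.

Lemma dis_disapp (o : 'I_l -> 'I_m) (C : nat -> nat) (i : 'I_n) t :
  (forall k : 'I_l, C k = o k) ->
  dis l (input_bit (encode D A) m l) C i t = disapp D o i t.
Proof.
move=> h; rewrite /dis /disapp big_mkord -sum1dep_card [RHS]big_mkcond /=.
apply: eq_bigr => k _; rewrite /cell h encode_bit.
by case: (k < t) => //=; case: (_ \in _).
Qed.

Lemma solvable_min_max :
  solvable (encode D A) n m l (size A) (3 + n * l * m + 1) <-> min_max_dec D A.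
Proof.
split=> [[C vC /viol_eq0 hC]|[o ho]].
- exists (fun k => Ordinal (vC _ (ltn_ord k))) => c /(nthP (0, 0))[j hj <-].
  apply/bigmax_leqP => i _.
  by rewrite -(@dis_disapp _ C) // -encode_time // -encode_bound //; apply: hC.
(* The value 0 beyond [l] is never inspected. *)
- pose C k := if insub k is Some x then val (o x) else 0.
  have CE k : C (val k) = o k by rewrite /C valK.
  exists C; first by move=> k hk; rewrite -[k]/(val (Ordinal hk)) CE.
  apply/viol_eq0 => j i hj hi.
  rewrite encode_time // encode_bound // -[i]/(val (Ordinal hi)) (dis_disapp _ _ CE).
  have := ho _ (mem_nth (0, 0) hj) => /bigmax_leqP; exact.
Qed.
End Encoding.

Lemma min_max_dec_trivial n m l (D : 'I_n -> 'I_l -> {set 'I_m}) A :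
  (n == 0) || (l == 0) -> 0 < m -> min_max_dec D A.
Proof.
move=> nl m0; exists (fun _ => Ordinal m0) => c _; apply/bigmax_leqP => i _.
case/orP: nl => /eqP z; first by have := ltn_ord i; lia.
apply: leq_trans (max_card _) _; by rewrite card_ord z.
Qed.

Lemma min_max_dec_noproject n l (D : 'I_n -> 'I_l -> {set 'I_0}) A :
  min_max_dec D A <-> l = 0.
Proof.
split=> [[o _]|z]; first by case: l D o => // l D o; case: (o ord0).
have no (k : 'I_l) : False by have := ltn_ord k; lia.
exists (fun k => False_rect _ (no k)) => c _; apply/bigmax_leqP => i _.
apply: leq_trans (max_card _) _; by rewrite card_ord z.
Qed.

(* Dominates every loop bound that depends on [d = tau * n] only. *)
Definition growth d := 2 ^ 2 ^ (2 * d + 2).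

Lemma growth_bounds d (g := clamp_radius d) :
  [/\ d <= growth d, (2 ^ d).*2 <= growth d, (g + g).+1 <= growth d &
      (g + g).+1 ^ d <= growth d].
Proof.
(* With g = 2^u and u = 2^(d+1), the base is at most 2^(u+2), and (u+2)(d+1) <= 2^(d+2) 2^d. The
   four bounds all follow from this one. *)
have key : (g + g).+1 ^ d.+1 <= growth d.
  pose u := (2 ^ d).*2.
  have hg : (g + g).+1 <= 2 ^ (u + 2).
    have -> : 2 ^ (u + 2) = g * 4 by rewrite expnD.
    have : 0 < g by rewrite expn_gt0.
    lia.
  apply: leq_trans (_ : (2 ^ (u + 2)) ^ d.+1 <= _); first by rewrite leq_exp2r.
  rewrite -expnM leq_exp2l // (_ : 2 * d + 2 = d.+2 + d); last lia.
  rewrite expnD leq_mul //; last exact: ltn_expl.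
  by rewrite !expnS /u; have : 0 < 2 ^ d by [rewrite expn_gt0]; lia.
have B0 : 0 < (g + g).+1 by [].
have h1 : (g + g).+1 <= growth d by apply: leq_trans key; rewrite expnS leq_pmulr ?expn_gt0.
have h2 : (2 ^ d).*2 <= (g + g).+1.
  by apply: leq_trans (ltnW (@ltn_expl 2 _ isT)) _; rewrite -/(clamp_radius d) -/g; lia.
split=> //; first 1 last.
- exact: leq_trans h2 h1.
- by apply: leq_trans key; rewrite expnS leq_pmull.
- apply: leq_trans h1; apply: leq_trans h2; have := @ltn_expl 2 d isT; lia.
Qed.

(** With E = 2^(2d+2), the factors 3C, 2^c and 2^(E c) multiply to at most 2^(E (3C+2c)), and 3C+2c
    <= 2^(3C+2c) moves the constants into the inner exponent. *)
Lemma time_bound_fpt C c d x z : 2 * d <= x * x -> 0 < z ->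
  3 * C * (growth d * z).+1 ^ c <= 2 ^ 2 ^ (x * x + (3 * C + 2 * c + 2)) * z ^ c.
Proof.
move=> hd z0.
have G0 : 0 < growth d by rewrite expn_gt0.
apply: leq_trans (_ : 3 * C * (2 * growth d * z) ^ c <= _).
  rewrite leq_mul2l; apply/orP; right.
  case: c => // c; rewrite leq_exp2r // -mulnA mul2n -addnn -addn1 leq_add2l.
  by rewrite muln_gt0 G0.
rewrite expnMn mulnA leq_mul2r; apply/orP; right.
rewrite expnMn; apply: leq_trans (_ : 2 ^ (3 * C) * (2 ^ c * growth d ^ c) <= _).
  by rewrite leq_mul2r (ltnW (ltn_expl _ (isT : 1 < 2))) orbT.
rewrite /growth -expnM -!expnD leq_exp2l //.
set E := 2 ^ (2 * d + 2).
have E0 : 0 < E by rewrite expn_gt0.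
apply: leq_trans (_ : E * 2 ^ (3 * C + 2 * c) <= _); last first.
  by rewrite /E -expnD leq_exp2l //; lia.
apply: leq_trans (_ : E * (3 * C + 2 * c) <= _); last first.
  by rewrite leq_mul2l (ltnW (ltn_expl _ (isT : 1 < 2))) orbT.
nia.
Qed.

(** * Computability of the time bound *)

Lemma loops_le_time_program K inp :
  exists W, loops_le inp W (time_program K) (initial_store inp).
Proof.
pose s1 := exec inp (vN <~ Input 0 ;; mul_into vM vN vN ;; vM <~ $vM :+ Const K)
  (initial_store inp).
pose s2 := exec inp (pow2_into vU vM) s1.
exists (nth 0 inp 0 + vars s1 vM + vars s2 vU); split; [|split].
- split=> //; split=> //.
  apply: (@fixed_bounds_loops_le _ [:: vN]) => // y; rewrite inE => /eqP->.
  by rewrite /= /upd /= -addnA leq_addr.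
- rewrite -/s1; clearbody s1; apply: (@fixed_bounds_loops_le _ [:: vM]) => // y.
  by rewrite inE => /eqP->; lia.
- rewrite -/s1 -/s2; clearbody s2; apply: (@fixed_bounds_loops_le _ [:: vU]) => // y.
  by rewrite inE => /eqP->; lia.
Qed.

Lemma time_program_correct K x :
  vars (exec [:: x] (time_program K) (initial_store [:: x])) vAns = 2 ^ 2 ^ (x * x + K).
Proof.
rewrite /time_program exec_seq; set s1 := exec _ (vN <~ _ ;; _) _.
have h1 : vars s1 vM = x * x + K.
  rewrite /s1 exec_seq; set s0 := exec _ (vN <~ _) _; rewrite exec_seq.
  have := @mul_into_correct [:: x] vM vN vN s0 isT isT isT isT.
  set s := exec _ (mul_into _ _ _) _; clearbody s => h.
  by rewrite /= /upd /= h.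
clearbody s1; rewrite exec_seq; set s2 := exec _ (pow2_into vU vM) _.
have h2 : vars s2 vU = 2 ^ (x * x + K) by rewrite /s2 pow2_into_correct // h1.
by clearbody s2; rewrite pow2_into_correct // h2.
Qed.

Lemma computable_time K : computable (fun x => 2 ^ 2 ^ (x * x + K)).
Proof.
exists (compile 0 0 (time_program K)) => x.
have [W hW] := loops_le_time_program K [:: x].
have [|j [_ h1 h2]] := compile_run _ hW; first by [].
by exists j; split=> //; rewrite h2 time_program_correct.
Qed.

(** * Correctness and running time of the whole program *)

Lemma program_correct n m l (D : 'I_n -> 'I_l -> {set 'I_m}) A
    (inp := encode D A) (s := exec inp program (initial_store inp)) :
  vars s vAns = 1 /\ min_max_dec D A \/ vars s vAns = 0 /\ ~ min_max_dec D A.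
Proof.
rewrite {}/s /program exec_seq; set s1 := exec inp (vN <~ _ ;; _) _.
have hn : vars s1 vN = n by [].
have hm : vars s1 vM = m by [].
have hl : vars s1 vL = l by [].
clearbody s1.
rewrite exec_if (_ : eval _ _ s1 = m) //; case: (posnP m) => m0.
  rewrite /= /upd /= hl.
  have triv : min_max_dec D A <-> l = 0.
    by move: (D); rewrite m0 => D'; apply: min_max_dec_noproject.
  by case: (posnP l) => l0; [left|right]; rewrite triv; split; lia.
rewrite exec_if (_ : eval _ _ s1 = n) //; case: (posnP n) => n0.
  by left; split=> //; apply: min_max_dec_trivial; rewrite ?n0.
rewrite exec_if (_ : eval _ _ s1 = l) //; case: (posnP l) => l0.
  by left; split=> //; apply: min_max_dec_trivial; rewrite ?l0 ?orbT.
rewrite exec_seq.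
have hb := setup_correct hn hm hl (encode_tau D A).
have := search_correct (@encode_bit_le1 _ _ _ D A) hb m0 (group_bound_lt _).
by rewrite (solvable_min_max D A).
Qed.

Lemma program_loops_le n m l (D : 'I_n -> 'I_l -> {set 'I_m}) A (inp := encode D A) :
  loops_le inp (growth (size A * n) * size inp) program (initial_store inp).
Proof.
rewrite /program; split; first by [].
set s1 := exec inp (vN <~ _ ;; _) _.
have hn : vars s1 vN = n by [].
have hm : vars s1 vM = m by [].
have hl : vars s1 vL = l by [].
clearbody s1; set W := _ * _.
have hW x : x <= size inp -> x <= W by move=> /leq_trans -> //; rewrite leq_pmull ?expn_gt0.
have hG x : x <= growth (size A * n) -> x <= W.
  by move=> /leq_trans -> //; rewrite leq_pmulr // /inp size_encode; lia.
rewrite loops_le_if (_ : eval _ _ s1 = m) //; case: (posnP m) => // m0.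
rewrite loops_le_if (_ : eval _ _ s1 = n) //; case: (posnP n) => // n0.
rewrite loops_le_if (_ : eval _ _ s1 = l) //; case: (posnP l) => // l0.
have sz : size inp = 3 + n * l * m + 1 + 2 * size A by exact: size_encode.
have nl0 : 0 < n * l by rewrite muln_gt0 n0.
have wn : n <= W by apply: hW; rewrite sz; nia.
have wm : m <= W by apply: hW; rewrite sz; nia.
have wl : l <= W by apply: hW; rewrite sz; nia.
have wt : size A <= W by apply: hW; rewrite sz; lia.
have [g1 g2 g3 g4] := growth_bounds (size A * n).
have hb := setup_correct hn hm hl (encode_tau D A).
split.
  by apply: setup_loops_le hn hm hl (encode_tau D A) _ _ _ _ _ _ => //; apply: hG.
apply: (search_loops_le (@encode_bit_le1 _ _ _ D A) hb m0) => //; try exact: hG.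
(* The number of rounds is at most tau n l, where tau n is at most [growth] and l is at most the
   input length. *)
by apply: leq_mul => //; rewrite sz; nia.
Qed.

Theorem theorem3 :
  exists (prog : seq instr) (f : nat -> nat) (c : nat),
    computable f /\
    forall (n m l : nat) (D : 'I_n -> 'I_l -> {set 'I_m}) (A : seq (nat * nat)),
      valid_constraints l A ->
      exists j, j <= f (n + size A) * size (encode D A) ^ c /\
        halted prog (run prog (encode D A) j) /\
        ((regs (run prog (encode D A) j) 0 = 1 /\ min_max_dec D A) \/
         (regs (run prog (encode D A) j) 0 = 0 /\ ~ min_max_dec D A)).
Proof.
pose C := cmd_size program; pose c := depth program.
exists (compile 0 0 program), (fun x => 2 ^ 2 ^ (x * x + (3 * C + 2 * c + 2))), c.
split; first exact: computable_time.
move=> n m l D A _.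
have [|j [tj hj rj]] := compile_run _ (program_loops_le D A); first by vm_compute.
exists j; split; last first.
  by split=> //; rewrite rj; apply: program_correct.
apply: leq_trans tj (leq_trans (time_bound_poly _ _) _).
apply: time_bound_fpt; last by rewrite size_encode; lia.
(* This is 2 n tau <= (n + tau)^2. *)
by move: (size A) => t; nia.
Qed.
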